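(* Let $V\in U_n$; denote by $\lambda_1$ (with multiplicity $n_1$), $\dots$, $\lambda_r$ (with multiplicity $n_r$) its distinct eigenvalues, and choose $R\in U_n$ such that $V=Ad_R\big(\bigoplus_{j=1}^r\lambda_jI_{n_j}\big)$. Then: (a) $M\in\langle V\rangle_{U_n}$ if and only if $M=Ad_R\big(\bigoplus_{j=1}^rM_j\big)$ with $M_j\in U_{n_j}$ for $j=1,\dots,r$; (b) if $M=Ad_R\big(\bigoplus_{j=1}^rM_j\big)\in\langle V\rangle_{U_n}$ (with $M_j\in U_{n_j}$), and $\zeta_j\ge0$ is the multiplicity of $-1$ as eigenvalue of $M_j$ ($1\le j\le r$), then the set $\langle V\rangle_{\mathfrak{u}_n}\text{-}plog(M)$ has $\prod_{j=1}^r(\zeta_j+1)$ connected components, which can be denoted $\mathcal{Z}(k_1,\dots,k_r)$ (for $k_j=0,1,\dots,\zeta_j$ and $j=1,\dots,r$) in such a way that each component $\mathcal{Z}(k_1,\dots,k_r)$ is a simply connected compact submanifold of $\mathfrak{u}_n$, diffeomorphic to the product of complex Grassmannians $\prod_{j=1}^r\mathbf{Gr}(k_j;\mathbb{C}^{\zeta_j})$.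
   Context: $U_n$ is the group of $n\times n$ complex unitary matrices, $\mathfrak{u}_n$ the real Lie algebra of $n\times n$ skew-hermitian matrices. $Ad_R(X):=RXR^{-1}$; $\bigoplus$ of matrices denotes the block-diagonal matrix. For $\mathcal{S}\subseteq\mathfrak{gl}_n(\mathbb{C})$, $\langle V\rangle_{\mathcal{S}}:=\{X\in\mathcal{S}: XV=VX\}$; the group $\langle V\rangle_{U_n}$ is a connected closed subgroup of $U_n$ with Lie algebra $\langle V\rangle_{\mathfrak{u}_n}$. If $G$ is a connected closed subgroup of $GL_n(\mathbb{C})$ with Lie algebra $\mathfrak{g}$ and $M\in G$, then $\mathfrak{g}\text{-}plog(M)$ is the set of all $L\in\mathfrak{g}$ such that $\exp(L)=M$ and $-\pi\le Im(\lambda)\le\pi$ for every eigenvalue $\lambda$ of $L$. $\mathbf{Gr}(k;\mathbb{C}^\zeta)$ is the Grassmannian of $k$-dimensional complex subspaces of $\mathbb{C}^\zeta$, with $\mathbb{C}^0=\{0\}$ (so $\mathbf{Gr}(0;\mathbb{C}^0)$ is a point). A number that is not an eigenvalue is said to be an eigenvalue of multiplicity zero. *)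

(* Defs.v *)
From HB Require Import structures.
From mathcomp Require Import all_boot all_order all_algebra.
From mathcomp Require Import complex.
From mathcomp Require Import all_classical all_reals all_analysis.
Set Implicit Arguments.
Unset Strict Implicit.
Unset Printing Implicit Defensive.
Import Order.TTheory GRing.Theory Num.Theory.
Import numFieldNormedType.Exports.
Local Open Scope classical_set_scope.
Local Open Scope sesquilinear_scope.
Local Open Scope ring_scope.

(** ** Complex matrices

    The complex numbers are [K[i]] for a [K : realType]; ['M[K[i]]_(m, n)] has
    the library topology (entrywise convergence for the modulus). *)

(* The library provides the norm topology for abstract number fields only; here
   it is transported to the concrete field [K[i]]. *)
#[non_forgetful_inheritance]
HB.instance Definition _ (K : realType) := GRing.ComAlgebra.copy K[i] (K[i]^o).
#[non_forgetful_inheritance]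
HB.instance Definition _ (K : realType) := Vector.copy K[i] (K[i]^o).
#[non_forgetful_inheritance]
HB.instance Definition _ (K : realType) := NormedModule.copy K[i] (K[i]^o).

Section ComplexMatrices.
Variable K : realType.
Local Notation C := K[i].

Definition unitary_group (n : nat) : set 'M[C]_n := [set X | X \is unitarymx].

Definition skew_hermitian (n : nat) : set 'M[C]_n := [set X | X ^t* = - X].

Definition Ad n (P X : 'M[C]_n) : 'M[C]_n := P *m X *m invmx P.

(* The cast identifies matrices of size [\sum_j n_ j] with those of size [n]. *)
Definition block_sum n r (n_ : 'I_r -> nat) (sum_n : (\sum_j n_ j)%N = n)
    (B : forall j, 'M[C]_(n_ j)) : 'M[C]_n :=
  castmx (sum_n, sum_n) (\mxdiag_j B j).

Definition commutant n (S : set 'M[C]_n) (V : 'M[C]_n) : set 'M[C]_n :=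
  [set X | S X /\ X *m V = V *m X].

(* Algebraic multiplicity; it is 0 when [a] is not an eigenvalue. *)
Definition eigen_mult n (X : 'M[C]_n) (a : C) : nat := mup a (char_poly X).

Definition expmx n (L : 'M[C]_n) : 'M[C]_n :=
  lim (series (fun k : nat => (k`!%:R : C)^-1 *: L ^+ k) @ \oo).

Definition plog n (g : set 'M[C]_n) (M : 'M[C]_n) : set 'M[C]_n :=
  [set L | [/\ g L, expmx L = M &
     forall a : C, eigenvalue L a -> - pi <= complex.Im a <= pi]].

(* Real and imaginary parts: ['M[C]_(m, n)] as a real vector space. *)
Definition realify m n (X : 'M[C]_(m, n)) : 'M[K]_(m, n) * 'M[K]_(m, n) :=
  (map_mx (@complex.Re K) X, map_mx (@complex.Im K) X).

Definition complexify m n (X : 'M[K]_(m, n) * 'M[K]_(m, n)) : 'M[C]_(m, n) :=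
  \matrix_(i, j) Complex (X.1 i j) (X.2 i j).

End ComplexMatrices.
Arguments unitary_group K n : clear implicits.
Arguments skew_hermitian K n : clear implicits.

(** ** Topology of subsets *)

Definition components (T : topologicalType) (A : set T) : set (set T) :=
  [set connected_component A x | x in A].

Section SimplyConnected.
Variables (K : realType) (T : topologicalType).
Local Notation I := [set t : K | 0 <= t <= 1].

Definition path_in (S : set T) (x y : T) (p : K -> T) : Prop :=
  [/\ {within I, continuous p}, p @` I `<=` S, p 0 = x & p 1 = y].

Definition null_homotopic (S : set T) (x : T) (p : K -> T) : Prop :=
  exists H : K * K -> T,
    [/\ {within I `*` I, continuous H}, H @` (I `*` I) `<=` S,
        (forall t, I t -> H (0, t) = p t /\ H (1, t) = x) &
        (forall s, I s -> H (s, 0) = x /\ H (s, 1) = x)].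

Definition simply_connected (S : set T) : Prop :=
  [/\ S !=set0,
      (forall x y, S x -> S y -> exists p, path_in S x y p) &
      (forall x p, path_in S x x p -> null_homotopic S x p)].

End SimplyConnected.

(** ** Smooth maps, submanifolds and diffeomorphisms *)

Section Smooth.
Variable K : realType.

(* On an open subset of a finite-dimensional space this is the usual class
   C^k: all iterated directional derivatives up to order [k] exist and are
   continuous. *)
Fixpoint Ck_on (V W : normedModType K) (k : nat) (D : set V) (f : V -> W) :
    Prop :=
  (forall x, D x -> {for x, continuous f}) /\
  if k is k'.+1 then
    forall v : V, (forall x, D x -> derivable f x v) /\ Ck_on k' D ('D_v f)
  else True.

Definition smooth_on (V W : normedModType K) (D : set V) (f : V -> W) : Prop :=
  forall k, Ck_on k D f.

(* An inverse chart: an open domain in R^m with a map from it into [T] (only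
   the values of the map on the domain matter).  A smooth structure on a
   subset of [T] is presented by an atlas, a set of inverse charts. *)
Definition param (T : Type) (m : nat) : Type :=
  (set 'rV[K]_m * ('rV[K]_m -> T))%type.

(* Smoothness at every point of [X], read in inverse charts around the point
   and around its image: [f \o phi = psi \o h] with [h] smooth. *)
Definition smooth_map (T T' : Type) (m m' : nat)
    (A : set (param T m)) (A' : set (param T' m')) (X : set T) (f : T -> T') :
    Prop :=
  forall x, X x -> exists (phi : param T m) (psi : param T' m') (u : 'rV[K]_m)
      (O : set 'rV[K]_m) (h : 'rV[K]_m -> 'rV[K]_m'),
    [/\ A phi /\ A' psi, phi.1 u /\ phi.2 u = x,
        [/\ open O, O u & O `<=` phi.1],
        smooth_on O h /\ h @` O `<=` psi.1 &
        forall w, O w -> f (phi.2 w) = psi.2 (h w)].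

Definition diffeomorphic (T T' : Type) (m m' : nat)
    (A : set (param T m)) (X : set T) (A' : set (param T' m')) (X' : set T') :
    Prop :=
  exists (f : T -> T') (g : T' -> T),
    [/\ f @` X `<=` X' /\ g @` X' `<=` X,
        (forall x, X x -> g (f x) = x),
        (forall y, X' y -> f (g y) = y),
        smooth_map A A' X f &
        smooth_map A' A X' g].

(* Local parametrizations of a subset [S] of a normed space: smooth maps from
   an open subset of R^m onto a relatively open subset [S `&` O] of [S], with
   an inverse that is the restriction of a smooth map on [O]. *)
Definition local_params {V : normedModType K} (m : nat) (S : set V) :
    set (param V m) :=
  [set phi | [/\ open phi.1, smooth_on phi.1 phi.2 &
    exists (O : set V) (g : V -> 'rV[K]_m),
      [/\ open O, smooth_on O g, phi.2 @` phi.1 = S `&` O &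
          forall u, phi.1 u -> g (phi.2 u) = u]]].

(* Embedded submanifolds of dimension [m]; their smooth structure is given by
   the atlas [local_params m S].  A subset of a linear subspace of [V] is an
   embedded submanifold of the subspace iff it is one of [V]. *)
Definition submanifold (V : normedModType K) (m : nat) (S : set V) : Prop :=
  forall x, S x -> exists2 phi, @local_params V m S phi & (phi.2 @` phi.1) x.

End Smooth.
Arguments local_params {K V} m S.
Arguments submanifold {K V} m S.

(** ** Products of complex Grassmannians *)

Section Grassmannian.
Variable K : realType.
Local Notation C := K[i].

Definition row_space k z (X : 'M[C]_(k, z)) : {vspace 'rV[C]_z} :=
  <<[tuple row i X | i < k]>>%VS.

Definition Gr (k z : nat) : set {vspace 'rV[C]_z} :=
  [set U | \dim U = k].

Variables (r : nat) (k z : 'I_r -> nat).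

Definition prod_Gr : set (forall j, {vspace 'rV[C]_(z j)}) :=
  [set U | forall j, Gr (k j) (U j)].

(* The complex dimension of the product. *)
Definition prod_Gr_dim : nat := (\sum_j k j * (z j - k j))%N.

(* The [j]-th factor, a [k j] x ([z j] - [k j]) complex matrix, of a point of
   R^(2d) = C^d, where [d = prod_Gr_dim]. *)
Definition graph_coord (w : 'rV[K]_(prod_Gr_dim + prod_Gr_dim)) (j : 'I_r) :
    'M[C]_(k j, z j - k j) :=
  vec_mx (submxrow (complexify (lsubmx w, rsubmx w)) j).

(* The product of the standard affine charts.  If the rows of [A] and [B]
   together form a basis of C^z, the subspaces complementary to the row space
   of [B] are the graphs of the linear maps from the row space of [A] to that
   of [B]: the matrix [X] of such a map gives the row space of [A + X *m B]. *)
Definition prod_Gr_atlas :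
    set (param K (forall j, {vspace 'rV[C]_(z j)})
           (prod_Gr_dim + prod_Gr_dim)) :=
  [set phi | exists (A : forall j, 'M[C]_(k j, z j))
                    (B : forall j, 'M[C]_(z j - k j, z j)),
    (forall j, row_full (col_mx (A j) (B j))) /\
    phi = (setT, fun w j => row_space (A j + graph_coord w j *m B j))].

End Grassmannian.
Arguments prod_Gr K {r} k z.
Arguments prod_Gr_atlas K {r} k z.

(* Main.v *)
(* The unitary V and M are diagonalised simultaneously, by some unitary Q.  A
   skew-hermitian L with exp L = M commutes with M and is determined on the
   eigenspaces of M for the eigenvalues other than -1; if it also commutes with
   V, it preserves the intersection of the eigenspace for -1 with the j-th
   eigenspace of V, a space of dimension zeta_j on which L has the eigenvalues
   i pi and - i pi only, i.e. L = i pi (2 Pi_j - 1) for an orthogonal projector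
   Pi_j.  With W_j the matrix of an orthonormal basis of that space, the set of
   logarithms is the image of the product of the sets of orthogonal projectors
   of C^(zeta_j) under the affine map Pi |-> L_0 + sum_j 2 i pi W_j^* Pi_j W_j,
   whose inverse is affine as well.  The ranks of the Pi_j label the components.

   Projectors of rank k are parametrised near a given one by k x (z - k) matrices
   X, as the projectors onto the row spaces of A + X B for a unitary matrix with
   upper block A and lower block B.  In these charts, passing from a projector to
   its row space is the identity map.  Simple connectedness follows from the
   convexity of the charts: any two projectors lie in a common chart, and two
   charts meet in a path-connected set, the complement of a complex hypersurface
   in a chart, so a loop can be contracted to its base point piece by piece. *)

Require Import Defs.
From HB Require Import structures.
From mathcomp Require Import all_boot all_order all_algebra.
From mathcomp Require Import complex.
From mathcomp Require Import all_classical all_reals all_analysis.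
From mathcomp Require Import ring lra.
Import Order.TTheory GRing.Theory Num.Theory.
Import numFieldNormedType.Exports.
Local Open Scope classical_set_scope.
Local Open Scope ring_scope.
Set Implicit Arguments.
Unset Strict Implicit.
Unset Printing Implicit Defensive.

(** The freedom in a logarithm sits where two admissible angles have the same exponential.
    Eigenvalues of [M] are given angles in (-pi, pi], those of a logarithm lie in the closed
    interval [-pi, pi], so only -1 leaves a choice. The matrix L_0 takes -pi throughout, and adding
    2 i pi on the range of a projector switches to pi there. That two projectors share a chart, and
    that chart domains meet in path-connected sets, comes from one remark: along a complex line the
    relevant determinants are polynomials in one variable, so finitely many parameters are bad, and
    in the complex plane they can be bypassed. A loop is contracted up to a supremum. Each step uses
    a chart that contains the base point, where linear interpolation is available; the obstacle is
    the passage from one chart to the next, so the last edge of the contracted part must be free to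
    lie in any chart that contains its end points. Ranks separate the components because the rank of
    a projector is its trace: a continuous function with integer values is constant on connected
    sets. *)

(** * Functions of class C^k between real normed spaces *)

Section SmoothCalculus.
Variable K : realType.
Implicit Types V W : normedModType K.

Lemma Ck_onS V W k (D : set V) (f : V -> W) : Ck_on k.+1 D f -> Ck_on k D f.
Proof.
elim: k f => [f []|k IH f [cf df]]; first by [].
by split=> // v; have [? ?] := df v; split=> //; exact: IH.
Qed.

(** Agreement on an open set is agreement near each of its points, so it passes to directional
    derivatives. The rules below use this to replace a derivative by its closed formula. *)
Lemma eq_Ck_on V W k (D : set V) (f g : V -> W) :
  open D -> (forall x, D x -> f x = g x) -> Ck_on k D f -> Ck_on k D g.
Proof.
move=> oD; elim: k f g => [|k IH] f g fg [cf df].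
  split=> // x Dx; apply: (cvg_trans _ (cvg_trans (cf x Dx) _)); last by rewrite fg.
  by apply: near_eq_cvg; apply: filterS (open_nbhs_nbhs (conj oD Dx)) => y /fg.
have nfg x : D x -> \forall y \near x, f y = g y.
  by move=> Dx; apply: filterS (open_nbhs_nbhs (conj oD Dx)) => y /fg.
split.
  move=> x Dx; apply: (cvg_trans _ (cvg_trans (cf x Dx) _)); last by rewrite fg.
  by apply: near_eq_cvg; exact: nfg.
move=> v; have [dfv Cdf] := df v; split=> [x Dx|].
  by apply: near_eq_derivable (dfv x Dx); exact: nfg.
apply: IH Cdf => x Dx; exact/near_eq_derive/nfg.
Qed.

Lemma Ck_on_cst V W k (D : set V) (c : W) : open D -> Ck_on k D (cst c : V -> W).
Proof.
move=> oD; elim: k c => [|k IH] c.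
  by split=> // x _; exact: cst_continuous.
split=> [x _|v]; first exact: cst_continuous.
split=> [x _|]; first exact: derivable_cst.
by apply: eq_Ck_on (IH 0) => // x _; rewrite derive_cst.
Qed.

Lemma Ck_onD V W k (D : set V) (f g : V -> W) : open D ->
  Ck_on k D f -> Ck_on k D g -> Ck_on k D (fun x => f x + g x).
Proof.
move=> oD; elim: k f g => [|k IH] f g [cf df] [cg dg].
  by split=> // x Dx; apply: cvgD; [exact: cf|exact: cg].
split=> [x Dx|v]; first by apply: cvgD; [exact: cf|exact: cg].
have [df1 df2] := df v; have [dg1 dg2] := dg v; split=> [x Dx|].
  by apply: derivableD; [exact: df1|exact: dg1].
apply: eq_Ck_on (IH _ _ df2 dg2) => // x Dx.
by rewrite [RHS]deriveD //; [exact: df1|exact: dg1].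
Qed.

Lemma Ck_onM V k (D : set V) (f g : V -> K^o) : open D ->
  Ck_on k D f -> Ck_on k D g -> Ck_on k D (fun x => f x * g x : K^o).
Proof.
move=> oD; elim: k f g => [|k IH] f g Cf Cg.
  by split=> // x Dx; apply: cvgM; [exact: Cf.1|exact: Cg.1].
split=> [x Dx|v]; first by apply: cvgM; [exact: Cf.1|exact: Cg.1].
have [df1 df2] := Cf.2 v; have [dg1 dg2] := Cg.2 v; split=> [x Dx|].
  by apply: derivableM; [exact: df1|exact: dg1].
have Cfg := Ck_onD oD (IH _ _ (Ck_onS Cf) dg2) (IH _ _ (Ck_onS Cg) df2).
apply: eq_Ck_on Cfg => // x Dx.
by rewrite [RHS]deriveM //; [exact: df1|exact: dg1].
Qed.

(** The derivative of 1/f is -(1/f)^2 f', and 1/f is of class C^k by induction, so the product rule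
    applies. *)
Lemma Ck_onV V k (D : set V) (f : V -> K^o) : open D ->
  (forall x, D x -> f x != 0) ->
  Ck_on k D f -> Ck_on k D (fun x => (f x)^-1 : K^o).
Proof.
move=> oD f0; elim: k => [|k IH] Cf.
  by split=> // x Dx; apply: cvgV; [exact: f0|exact: Cf.1].
split=> [x Dx|v]; first by apply: cvgV; [exact: f0|exact: Cf.1].
have [df1 df2] := Cf.2 v; split=> [x Dx|].
  by apply: derivableV; [exact: f0|exact: df1].
have CV := IH (Ck_onS Cf).
have CfV := Ck_onM oD (Ck_on_cst k (-1 : K^o) oD) (Ck_onM oD (Ck_onM oD CV CV) df2).
apply: eq_Ck_on CfV => // x Dx.
rewrite [RHS]deriveV; [|exact: f0|exact: df1].
by rewrite /cst mulN1r -expr2 exprVn scaleNr.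
Qed.

Lemma Ck_onZl V W k (D : set V) (f : V -> K^o) (w : W) : open D ->
  Ck_on k D f -> Ck_on k D (fun x => f x *: w).
Proof.
move=> oD; elim: k f => [|k IH] f Cf.
  by split=> // x Dx; apply: cvgZr_tmp; exact: Cf.1.
split=> [x Dx|v]; first by apply: cvgZr_tmp; exact: Cf.1.
have [df1 df2] := Cf.2 v.
have lf x : D x ->
    h^-1 *: (((fun x => f x *: w) \o shift x) (h *: v) - f x *: w) @[h --> 0^'] -->
    'D_v f x *: w.
  move=> Dx; have /cvgZr_tmp - /(_ _ w) := df1 x Dx.
  by apply: cvg_trans; apply: near_eq_cvg; near=> h => /=; rewrite -scalerBl scalerA.
split=> [x Dx|]; first by apply/cvg_ex; exists ('D_v f x *: w); exact: lf.
by apply: eq_Ck_on (IH _ df2) => // x Dx; rewrite [RHS](cvg_lim _ (lf x Dx)).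
Unshelve. all: by end_near. Qed.

Lemma Ck_on_linear V W k (D : set V) (f : {linear V -> W}) : open D ->
  continuous f -> Ck_on k D f.
Proof.
move=> oD cf; case: k => [|k]; first by split=> // x _; exact: cf.
split=> [x _|v]; first exact: cf.
have df x : differentiable f x by exact: linear_differentiable.
split=> [x Dx|]; first by apply: diff_derivable.
apply: eq_Ck_on (Ck_on_cst k (f v) oD) => // x Dx.
by rewrite deriveE // diff_lin.
Qed.

Lemma smooth_on_cst V W (D : set V) (c : W) : open D -> smooth_on D (cst c).
Proof. by move=> oD k; exact: Ck_on_cst. Qed.

Lemma smooth_on_id V (D : set V) : open D -> smooth_on D (id : V -> V).
Proof. by move=> oD k; apply: (@Ck_on_linear _ _ k D idfun) => // x. Qed.

Lemma smooth_on_sum V W (D : set V) (I : finType) (f : I -> V -> W) : open D ->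
  (forall i, smooth_on D (f i)) -> smooth_on D (fun x => \sum_i f i x).
Proof.
move=> oD sf k.
have -> : (fun x => \sum_i f i x) = \sum_i f i.
  by apply/funext => x; rewrite fct_sumE.
elim/big_ind : _ => [|g h Cg Ch|i _]; first exact: Ck_on_cst.
- exact: Ck_onD.
- exact: sf.
Qed.

Lemma smooth_on_Zl V W (D : set V) (f : V -> K^o) (w : W) : open D ->
  smooth_on D f -> smooth_on D (fun x => f x *: w).
Proof. by move=> oD sf k; exact: Ck_onZl. Qed.

(** A matrix is the finite sum of its entries times elementary matrices, which leaves real-valued
    functions times fixed vectors. *)
Lemma smooth_on_mx V m n (D : set V) (f : V -> 'M[K]_(m, n)) : open D ->
  (forall i j, smooth_on D (fun x => f x i j : K^o)) -> smooth_on D f.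
Proof.
move=> oD sf.
have -> : f = fun x => \sum_(ij : 'I_m * 'I_n) f x ij.1 ij.2 *: delta_mx ij.1 ij.2.
  apply/funext => x; rewrite {1}(matrix_sum_delta (f x)).
  by rewrite (pair_bigA _ (fun i j => f x i j *: delta_mx i j)).
by apply: smooth_on_sum => // ij; exact: smooth_on_Zl.
Qed.

Lemma smooth_on_pair V m n p q (D : set V) (f : V -> 'M[K]_(m, n))
    (g : V -> 'M[K]_(p, q)) : open D ->
  (forall i j, smooth_on D (fun x => f x i j : K^o)) ->
  (forall i j, smooth_on D (fun x => g x i j : K^o)) ->
  smooth_on D (fun x => (f x, g x)).
Proof.
move=> oD sf sg k.
have -> : (fun x => (f x, g x)) = fun x =>
    \sum_(ij : 'I_m * 'I_n) f x ij.1 ij.2 *: ((delta_mx ij.1 ij.2, 0) : 'M[K]_(m, n) * 'M[K]_(p, q)) +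
    \sum_(ij : 'I_p * 'I_q) g x ij.1 ij.2 *: ((0, delta_mx ij.1 ij.2) : 'M[K]_(m, n) * 'M[K]_(p, q)).
  apply/funext => x.
  have -> (a : 'M[K]_(m, n) * 'M[K]_(p, q)) b : a + b = (a.1 + b.1, a.2 + b.2) by [].
  have fstS (I : finType) (F : I -> 'M[K]_(m, n) * 'M[K]_(p, q)) :
      (\sum_i F i).1 = \sum_i (F i).1 by apply: (big_morph fst).
  have sndS (I : finType) (F : I -> 'M[K]_(m, n) * 'M[K]_(p, q)) :
      (\sum_i F i).2 = \sum_i (F i).2 by apply: (big_morph snd).
  rewrite !fstS !sndS /=; congr (_, _).
    rewrite [X in _ + X]big1 ?addr0 => [|ij _]; last by rewrite scaler0.
    by rewrite {1}(matrix_sum_delta (f x)) (pair_bigA _ (fun i j => f x i j *: delta_mx i j)).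
  rewrite [X in X + _]big1 ?add0r => [|ij _]; last by rewrite scaler0.
  by rewrite {1}(matrix_sum_delta (g x)) (pair_bigA _ (fun i j => g x i j *: delta_mx i j)).
by apply: Ck_onD => //; apply: smooth_on_sum => // ij; apply: smooth_on_Zl.
Qed.

End SmoothCalculus.

(** * Smooth complex and matrix-valued functions of real variables *)

Section ComplexSmooth.
Variables (K : realType) (V : normedModType K) (D : set V).
Hypothesis oD : open D.
Local Open Scope sesquilinear_scope.
Local Notation C := K[i].

(** Smoothness is over [K], so complex values are read as pairs of real ones; conjugation, which is
    not complex-differentiable, is then smooth. *)
Definition csmooth (f : V -> C) : Prop :=
  smooth_on D (fun x => complex.Re (f x) : K^o) /\
  smooth_on D (fun x => complex.Im (f x) : K^o).

Definition mxsmooth m n (f : V -> 'M[C]_(m, n)) : Prop :=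
  forall i j, csmooth (fun x => f x i j).

Lemma eq_csmooth (f g : V -> C) :
  (forall x, D x -> f x = g x) -> csmooth f -> csmooth g.
Proof.
move=> fg [sR sI]; split=> k.
  by apply: eq_Ck_on (sR k) => // x /fg ->.
by apply: eq_Ck_on (sI k) => // x /fg ->.
Qed.

Lemma csmooth_cst c : csmooth (fun=> c).
Proof. by split; exact: smooth_on_cst. Qed.

Lemma csmoothD f g : csmooth f -> csmooth g -> csmooth (fun x => f x + g x).
Proof.
move=> [fR fI] [gR gI]; split=> k.
  by apply: eq_Ck_on (Ck_onD oD (fR k) (gR k)) => // x _; case: (f x) (g x) => ? ? [].
by apply: eq_Ck_on (Ck_onD oD (fI k) (gI k)) => // x _; case: (f x) (g x) => ? ? [].
Qed.

Lemma csmoothM f g : csmooth f -> csmooth g -> csmooth (fun x => f x * g x).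
Proof.
move=> [fR fI] [gR gI]; split=> k.
  have := Ck_onD oD (Ck_onM oD (fR k) (gR k))
    (Ck_onM oD (Ck_on_cst k (-1 : K^o) oD) (Ck_onM oD (fI k) (gI k))).
  apply: eq_Ck_on => // x _; rewrite /cst mulN1r.
  by case: (f x) (g x) => ? ? [].
have := Ck_onD oD (Ck_onM oD (fR k) (gI k)) (Ck_onM oD (fI k) (gR k)).
by apply: eq_Ck_on => // x _; case: (f x) (g x) => ? ? [].
Qed.

Lemma csmooth_conj f : csmooth f -> csmooth (fun x => (f x)^*).
Proof.
move=> [fR fI]; split=> k.
  by apply: eq_Ck_on (fR k) => // x _; case: (f x).
have := Ck_onM oD (Ck_on_cst k (-1 : K^o) oD) (fI k).
by apply: eq_Ck_on => // x _; rewrite /cst mulN1r; case: (f x).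
Qed.

(** 1/z is the conjugate of z over the real number |z|^2, which leaves the inverse of a real
    function. *)
Lemma csmoothV f : (forall x, D x -> f x != 0) -> csmooth f ->
  csmooth (fun x => (f x)^-1).
Proof.
move=> f0 sf.
have sfc := csmooth_conj sf.
have sn := csmoothM sf sfc.
have n0 x : D x -> complex.Re (f x * (f x)^*) != 0.
  move=> Dx; have := f0 x Dx; case: (f x) => a b; rewrite /=.
  rewrite eq_complex /= negb_and => ab0.
  rewrite mulrN opprK -!expr2 paddr_eq0 ?sqr_ge0 // !sqrf_eq0 negb_and //.
pose g x := Complex (complex.Re (f x * (f x)^*))^-1 0 : C.
have sg : csmooth g.
  split=> k; last exact: Ck_on_cst.
  by apply: (Ck_onV oD n0); exact: sn.1.
apply: eq_csmooth (csmoothM sfc sg) => x Dx.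
have fE : f x * (f x)^* = Complex (complex.Re (f x * (f x)^*)) 0.
  by case: (f x) => a b /=; congr Complex; rewrite mulrN mulrC addNr.
apply: (mulfI (f0 x Dx)); rewrite mulfV ?f0 // mulrA {1}fE /g.
rewrite -[Complex _ 0]/(_%:C%C) -[Complex _^-1 0]/(_%:C%C) -rmorphM.
by rewrite mulfV ?n0 // rmorph1.
Qed.

Lemma csmooth_sum (I : Type) (r : seq I) (P : pred I) (f : I -> V -> C) :
  (forall i, csmooth (f i)) -> csmooth (fun x => \sum_(i <- r | P i) f i x).
Proof.
move=> sf; elim: r => [|i r IH].
  by apply: eq_csmooth (csmooth_cst 0) => x _; rewrite big_nil.
case Pi : (P i).
  by apply: eq_csmooth (csmoothD (sf i) IH) => x _; rewrite big_cons Pi.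
by apply: eq_csmooth IH => x _; rewrite big_cons Pi.
Qed.

Lemma csmooth_prod (I : Type) (r : seq I) (P : pred I) (f : I -> V -> C) :
  (forall i, csmooth (f i)) -> csmooth (fun x => \prod_(i <- r | P i) f i x).
Proof.
move=> sf; elim: r => [|i r IH].
  by apply: eq_csmooth (csmooth_cst 1) => x _; rewrite big_nil.
case Pi : (P i).
  by apply: eq_csmooth (csmoothM (sf i) IH) => x _; rewrite big_cons Pi.
by apply: eq_csmooth IH => x _; rewrite big_cons Pi.
Qed.

Lemma mxsmooth_cst m n (A : 'M[C]_(m, n)) : mxsmooth (fun=> A).
Proof. by move=> i j; exact: csmooth_cst. Qed.

Lemma mxsmoothD m n (f g : V -> 'M[C]_(m, n)) :
  mxsmooth f -> mxsmooth g -> mxsmooth (fun x => f x + g x).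
Proof.
by move=> sf sg i j; apply: eq_csmooth (csmoothD (sf i j) (sg i j)) => x _; rewrite mxE.
Qed.

Lemma mxsmoothZ m n c (f : V -> 'M[C]_(m, n)) :
  mxsmooth f -> mxsmooth (fun x => c *: f x).
Proof.
move=> sf i j.
by apply: eq_csmooth (csmoothM (csmooth_cst c) (sf i j)) => x _; rewrite mxE.
Qed.

Lemma mxsmoothM m n p (f : V -> 'M[C]_(m, n)) (g : V -> 'M[C]_(n, p)) :
  mxsmooth f -> mxsmooth g -> mxsmooth (fun x => f x *m g x).
Proof.
move=> sf sg i j.
apply: eq_csmooth (csmooth_sum _ _ (fun k => csmoothM (sf i k) (sg k j))) => x _.
by rewrite mxE.
Qed.

Lemma mxsmooth_adj m n (f : V -> 'M[C]_(m, n)) :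
  mxsmooth f -> mxsmooth (fun x => (f x)^t*).
Proof.
by move=> sf i j; apply: eq_csmooth (csmooth_conj (sf j i)) => x _; rewrite !mxE.
Qed.

Lemma mxsmooth_sum m n (I : Type) (r : seq I) (P : pred I)
    (f : I -> V -> 'M[C]_(m, n)) :
  (forall i, mxsmooth (f i)) -> mxsmooth (fun x => \sum_(i <- r | P i) f i x).
Proof.
move=> sf a b; apply: eq_csmooth (csmooth_sum _ _ (fun i => sf i a b)) => x _.
by rewrite summxE.
Qed.

Lemma csmooth_det n (f : V -> 'M[C]_n) : mxsmooth f -> csmooth (fun x => \det (f x)).
Proof.
move=> sf; apply: csmooth_sum => s; apply: csmoothM; first exact: csmooth_cst.
by apply: csmooth_prod => i; exact: sf.
Qed.

(** Cramer's formula: cofactors are polynomials in the entries, and the determinant has no zero on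
    [D]. *)
Lemma mxsmooth_inv n (f : V -> 'M[C]_n) :
  (forall x, D x -> f x \in unitmx) -> mxsmooth f -> mxsmooth (fun x => invmx (f x)).
Proof.
move=> fu sf i j.
have sadj : csmooth (fun x => (\adj (f x)) i j).
  apply: (@eq_csmooth (fun x => cofactor (f x) j i)) => [x _|]; first by rewrite mxE.
  apply: csmoothM; first exact: csmooth_cst.
  apply: csmooth_det => a b.
  by apply: eq_csmooth (sf (lift j a) (lift i b)) => x _; rewrite !mxE.
have sdet : csmooth (fun x => (\det (f x))^-1).
  apply: csmoothV; last exact: csmooth_det.
  by move=> x /fu; rewrite unitmxE unitfE.
apply: eq_csmooth (csmoothM sdet sadj) => x Dx.
by rewrite /invmx fu // [RHS]mxE.
Qed.

Lemma smooth_on_realify m n (f : V -> 'M[C]_(m, n)) :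
  mxsmooth f -> smooth_on D (fun x => realify (f x)).
Proof.
move=> sf; apply: smooth_on_pair => // i j k.
  by apply: eq_Ck_on ((sf i j).1 k) => // x _; rewrite mxE.
by apply: eq_Ck_on ((sf i j).2 k) => // x _; rewrite mxE.
Qed.

End ComplexSmooth.

(** * Limits of complex and matrix-valued functions *)

Section ComplexContinuity.
Variable K : realType.
Local Open Scope sesquilinear_scope.
Local Notation C := K[i].
Variable T : topologicalType.

Lemma continuous_Re : continuous (@complex.Re K).
Proof.
move=> z A /(nbhs_ballP (complex.Re z)) [e e0 eA].
apply/(nbhs_ballP z); exists (e%:C%C); first by rewrite /= ltcR.
move=> w zw; apply: eA.
have : `|z - w| < e%:C%C by [].
move=> /(le_lt_trans (normc_ge_Re (z - w))); rewrite ltcR /ball /=.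
by case: (z) (w) => ? ? [].
Qed.

Lemma continuous_real_complex : continuous (fun x : K => x%:C%C : C).
Proof.
move=> z A /(nbhs_ballP (z%:C%C)) [e e0 eA].
(* Radii of balls in [K[i]] are positive elements of [K[i]], hence real. *)
have [r0 eE] : 0 < complex.Re e /\ e = (complex.Re e)%:C%C.
  by case: e e0 {eA} => a b /=; rewrite ltcE /= => /andP[/eqP -> ?].
apply/(nbhs_ballP z); exists (complex.Re e) => // w zw; apply: eA.
rewrite /ball /= eE normc_def /= subr0 expr0n addr0 sqrtr_sqr ltcR.
exact: zw.
Qed.

Lemma continuous_conj : continuous (Num.conj : C -> C).
Proof.
move=> z A /(nbhs_ballP (z^*)) [e e0 eA].
apply/(nbhs_ballP z); exists e => // w zw; apply: eA.
rewrite /ball /= -rmorphB norm_conjC; exact: zw.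
Qed.

Lemma cvg_mx m n (F : set_system T) {FF : Filter F} (f : T -> 'M[C]_(m, n)) (A : 'M[C]_(m, n)) :
  (forall i j, (fun x => f x i j) @ F --> A i j) -> f @ F --> A.
Proof.
move=> fA B [P AP PB].
have : \forall x \near F, forall ij : 'I_m * 'I_n, P ij.1 ij.2 (f x ij.1 ij.2).
  by apply: filter_forall => -[i j] /=; exact: (fA i j _ (AP i j)).
by apply: filterS => x Px; apply: PB => i j; exact: (Px (i, j)).
Qed.

Section Cvg.
Context (F : set_system T) {FF : Filter F}.

Lemma cvg_1B (f : T -> C) (a : C) :
  f @ F --> a -> (fun x => 1 - f x) @ F --> 1 - a.
Proof.
have c1 : (fun _ : T => 1 : C) @ F --> (1 : C) by exact: cvg_cst.
by move=> fa; have := cvgB c1 fa; apply.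
Qed.

Lemma cvg_coord m n (f : T -> 'M[C]_(m, n)) (A : 'M[C]_(m, n)) i j :
  f @ F --> A -> (fun x => f x i j) @ F --> A i j.
Proof. by move=> fA; exact: (cvg_comp _ _ fA (@coord_continuous _ _ _ i j A)). Qed.

Lemma cvg_mxD m n (f g : T -> 'M[C]_(m, n)) (A B : 'M[C]_(m, n)) :
  f @ F --> A -> g @ F --> B -> (fun x => f x + g x) @ F --> A + B.
Proof. exact: cvgD. Qed.

Lemma cvg_mxZ m n (f : T -> C) (a : C) (g : T -> 'M[C]_(m, n)) (B : 'M[C]_(m, n)) :
  f @ F --> a -> g @ F --> B -> (fun x => f x *: g x) @ F --> a *: B.
Proof. exact: cvgZ. Qed.

Lemma cvg_mxM m n p (f : T -> 'M[C]_(m, n)) (g : T -> 'M[C]_(n, p))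
    (A : 'M[C]_(m, n)) (B : 'M[C]_(n, p)) :
  f @ F --> A -> g @ F --> B -> (fun x => f x *m g x) @ F --> A *m B.
Proof.
move=> fA gB; apply: cvg_mx => i j; rewrite mxE.
under eq_fun do rewrite mxE.
by apply: cvg_big => [|k _]; [exact: add_continuous|apply: cvgM; exact: cvg_coord].
Qed.

Lemma cvg_mxadj m n (f : T -> 'M[C]_(m, n)) (A : 'M[C]_(m, n)) :
  f @ F --> A -> (fun x => (f x)^t*) @ F --> A^t*.
Proof.
move=> fA; apply: cvg_mx => i j.
have -> : (fun x => (f x)^t* i j) = Num.conj \o (fun x => f x j i).
  by apply/funext => x; rewrite !mxE.
have -> : A^t* i j = (A j i)^* by rewrite !mxE.
have cAji := @continuous_conj (A j i).
exact: (cvg_comp _ _ (cvg_coord (i:=j) (j:=i) fA) cAji).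
Qed.

Lemma cvg_mxtrace n (f : T -> 'M[C]_n) (A : 'M[C]_n) :
  f @ F --> A -> (fun x => \tr (f x)) @ F --> \tr A.
Proof.
by move=> fA; apply: cvg_big => [|i _]; [exact: add_continuous|exact: cvg_coord].
Qed.

Lemma cvg_det n (f : T -> 'M[C]_n) (A : 'M[C]_n) :
  f @ F --> A -> (fun x => \det (f x)) @ F --> \det A.
Proof.
move=> fA; apply: cvg_big => [|s _]; first exact: add_continuous.
apply: cvgM; first exact: cvg_cst.
by apply: cvg_big => [|i _]; [exact: mul_continuous|exact: cvg_coord].
Qed.

(** The determinants are eventually nonzero, so the inverses are eventually given by Cramer's
    formula. *)
Lemma cvg_mxinv n (f : T -> 'M[C]_n) (A : 'M[C]_n) :
  A \in unitmx -> f @ F --> A -> (fun x => invmx (f x)) @ F --> invmx A.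
Proof.
move=> uA fA.
have dA : (fun x => \det (f x)) @ F --> \det A by exact: cvg_det.
have dA0 : \det A != 0 by rewrite -unitfE -unitmxE.
have fu : \forall x \near F, f x \in unitmx.
  by apply: filterS (cvgr_neq0 _ dA dA0) => x; rewrite unitmxE unitfE.
apply: (@cvg_trans _ ((fun x => (\det (f x))^-1 *: \adj (f x)) @ F)).
  by apply: near_eq_cvg; apply: filterS fu => x fxu; rewrite /invmx fxu.
rewrite /invmx uA; apply: cvg_mxZ; first exact: cvgV.
have adjE (B : 'M[C]_n) i j : (\adj B) i j = cofactor B j i by rewrite mxE.
apply: cvg_mx => i j.
have -> : (fun x => (\adj (f x)) i j) = (fun x => cofactor (f x) j i).
  by apply/funext => x; rewrite adjE.
rewrite [X in _ --> X]adjE.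
apply: cvgM; first exact: cvg_cst.
apply: cvg_det; apply: cvg_mx => a b; rewrite !mxE.
under eq_fun do rewrite !mxE.
exact: cvg_coord.
Qed.

End Cvg.
End ComplexContinuity.

(** * Orthogonal projectors and the charts on projectors of fixed rank *)

Section OrthogonalProjectors.
Variable C : numClosedFieldType.
Local Open Scope sesquilinear_scope.

Lemma adjmxM m n p (A : 'M[C]_(m, n)) (B : 'M[C]_(n, p)) :
  (A *m B)^t* = B^t* *m A^t*.
Proof. by rewrite trmx_mul map_mxM. Qed.

Lemma adjmxD m n (A B : 'M[C]_(m, n)) : (A + B)^t* = A^t* + B^t*.
Proof. by rewrite linearD map_mxD. Qed.

Lemma adjmx1 n : (1%:M : 'M[C]_n)^t* = 1%:M.
Proof. by rewrite trmx1 map_mx1. Qed.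

Lemma adjmx_inv n (A : 'M[C]_n) : (invmx A)^t* = invmx (A^t*).
Proof. by rewrite trmx_inv map_invmx. Qed.

Lemma unitmx_adj n (A : 'M[C]_n) : (A^t* \in unitmx) = (A \in unitmx).
Proof. by rewrite map_unitmx unitmx_tr. Qed.

Definition orthproj n (k : nat) (P : 'M[C]_n) : Prop :=
  [/\ P *m P = P, P^t* = P & \rank P = k].

(** The orthogonal projector onto the row space of [G], for [G] with independent rows. Vectors are
    rows and matrices act from the right. *)
Definition proj_on k n (G : 'M[C]_(k, n)) : 'M[C]_n :=
  G^t* *m invmx (G *m G^t*) *m G.

(** By Gram-Schmidt, [G] is an invertible matrix T times a matrix with orthonormal rows, so its Gram
    matrix is T times the adjoint of T. *)
Lemma unitmx_gram k n (G : 'M[C]_(k, n)) : row_free G -> G *m G^t* \in unitmx.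
Proof.
move=> fG; have kn : (k <= n)%N by move: fG => /eqP <-; exact: rank_leq_col.
have /submxP[T GE] := schmidt_sub G.
have uT : T \in unitmx.
  rewrite -row_free_unit -row_leq_rank.
  by move/eqP: fG => {1}<-; rewrite GE mxrankM_maxl.
rewrite GE adjmxM mulmxA mulmxtVK ?schmidt_unitarymx //.
by rewrite unitmx_mul uT unitmx_adj.
Qed.

Lemma orthproj_on k n (G : 'M[C]_(k, n)) :
  row_free G -> orthproj k (proj_on G) /\ (proj_on G :=: G)%MS.
Proof.
move=> fG; have uG := unitmx_gram fG.
have GP : G *m proj_on G = G by rewrite /proj_on !mulmxA mulmxV // mul1mx.
have eqG : (proj_on G :=: G)%MS.
  by apply/eqmxP; rewrite submxMl /= -{1}GP submxMl.
split=> //; split.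
- by rewrite {1}/proj_on -mulmxA GP.
- by rewrite /proj_on !adjmxM trmxCK adjmx_inv adjmxM trmxCK !mulmxA.
- by rewrite eqG; exact/eqP.
Qed.

(* Both products of two self-adjoint idempotents with the same row space are
   equal to one of the factors, hence so are their adjoints. *)
Lemma orthproj_uniq k n (P : 'M[C]_n) (G : 'M[C]_(k, n)) :
  orthproj k P -> row_free G -> (G <= P)%MS -> P = proj_on G.
Proof.
move=> [PP Pa rP] fG GP.
have [[_ Qa _] QG] := orthproj_on fG; set Q := proj_on G in Qa QG *.
have uG := unitmx_gram fG.
have GPE : G *m P = G by have /submxP[Y ->] := GP; rewrite -mulmxA PP.
have PG : (P <= G)%MS by rewrite -(geq_leqif (mxrank_leqif_sup GP)) rP (eqP fG).
have PQ : P *m Q = P.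
  have /submxP[Z ->] := PG.
  by rewrite -mulmxA /Q /proj_on !mulmxA -(mulmxA Z) -(mulmxA Z) mulmxV // mulmx1.
have QP : Q *m P = Q by rewrite /Q /proj_on -mulmxA GPE.
by rewrite -{1}Pa -PQ adjmxM Qa Pa.
Qed.

(** [G] is an orthonormal basis of the row space of [P]; its Gram matrix is the identity, so the
    inverse in [proj_on] disappears. *)
Lemma orthproj_gramP k n (P : 'M[C]_n) : orthproj k P ->
  exists2 G : 'M[C]_(k, n), G \is unitarymx & P = G^t* *m G.
Proof.
move=> oP; have [_ _ rP] := oP; case: _ / rP oP => oP.
pose G := schmidt (row_base P).
have uG : G \is unitarymx by exact/schmidt_unitarymx/rank_leq_col.
have fG : row_free G by rewrite /row_free mxrank_unitary.
have GP : (G <= P)%MS by rewrite (eqmx_schmidt_free (row_base_free P)) eq_row_base.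
exists G => //; apply: (etrans (orthproj_uniq oP fG GP)).
by rewrite /proj_on (unitarymxP uG) invmx1 mulmx1.
Qed.

Lemma orthproj_trace k n (P : 'M[C]_n) : orthproj k P -> \tr P = k%:R.
Proof.
move=> /orthproj_gramP[G uG ->].
by rewrite mxtrace_mulC (unitarymxP uG) mxtrace1.
Qed.

(** Since [P] is the product of itself and its adjoint, a diagonal entry is the sum of the squared
    moduli in its row. It therefore dominates its own square and is at most 1, and so are these
    moduli. *)
Lemma orthproj_entry_le1 k n (P : 'M[C]_n) i j : orthproj k P -> `|P i j| <= 1.
Proof.
move=> [PP Pa _].
have PE a : P a a = \sum_b `|P a b| ^+ 2.
  rewrite -{1}PP mxE; apply: eq_bigr => b _.
  by rewrite normCK; congr (_ * _); rewrite -{1}Pa !mxE.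
have le_ii b a : `|P a b| ^+ 2 <= P a a.
  by rewrite PE (bigD1 b) //= lerDl sumr_ge0 // => c _; rewrite exprn_ge0.
have Pii0 a : 0 <= P a a by rewrite PE sumr_ge0 // => c _; rewrite exprn_ge0.
have Pii1 a : P a a <= 1.
  have := le_ii a a; rewrite ger0_norm // expr2.
  have [->|Pn0] := eqVneq (P a a) 0; first by rewrite ler01.
  by rewrite ger_pMl // lt_def Pn0 Pii0.
by rewrite -(@expr_le1 _ 2) // (le_trans (le_ii j i)).
Qed.

(** [A] and [B] are the upper and lower blocks of a unitary matrix. Identities between blocks avoid
    the cast from size [k + (n - k)] to [n]. *)
Definition frame k n (A : 'M[C]_(k, n)) (B : 'M[C]_(n - k, n)) : Prop :=
  [/\ A *m A^t* = 1%:M, B *m B^t* = 1%:M, A *m B^t* = 0 &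
      A^t* *m A + B^t* *m B = 1%:M].

(** [B] is an orthonormal basis of the orthogonal complement of the rows of [A]. *)
Lemma frame_complete k n (A : 'M[C]_(k, n)) :
  A \is unitarymx -> exists B, frame A B.
Proof.
move=> uA; have kn : (k <= n)%N by rewrite -(mxrank_unitary uA) rank_leq_col.
have rA := mxrank_unitary uA.
pose O := kermx (A^t*).
have rO : \rank O = (n - k)%N by rewrite mxrank_ker mxrank_map mxrank_tr rA.
have [B uB BO] : exists2 B : 'M[C]_(n - k, n), B \is unitarymx & (B <= O)%MS.
  rewrite -rO; exists (schmidt (row_base O)).
    by apply: schmidt_unitarymx; exact: rank_leq_col.
  by rewrite (eqmx_schmidt_free (row_base_free O)) eq_row_base.
have BA : B *m A^t* = 0 by exact/sub_kermxP.
have AB : A *m B^t* = 0.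
  by rewrite -[LHS]trmxCK adjmxM trmxCK BA trmx0 map_mx0.
exists B; split=> //; [exact/unitarymxP|exact/unitarymxP|].
(* A square matrix with orthonormal rows is unitary on both sides; the other side is the last
   identity of a frame. *)
have uAB : col_mx A B \is unitarymx.
  apply/unitarymxP; rewrite tr_col_mx map_row_mx mul_col_row AB BA.
  by rewrite (unitarymxP uA) (unitarymxP uB) -scalar_mx_block.
have := mulmxKtV (1%:M : 'M[C]_n) uAB (subnKC kn).
by rewrite mul1mx tr_col_mx map_row_mx mul_row_col.
Qed.

Definition chart_map k n (A : 'M[C]_(k, n)) B (X : 'M[C]_(k, n - k)) : 'M[C]_n :=
  proj_on (A + X *m B).

(** If [P] projects onto the row space of [A + X *m B], then [A *m P] is N times this matrix, N
    being the inverse of its Gram matrix. Compressing by [A] gives N and compressing by [B] gives N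
    times X, whence X. *)
Definition chart_coord k n (A : 'M[C]_(k, n)) (B : 'M[C]_(n - k, n)) (P : 'M[C]_n) :
    'M[C]_(k, n - k) :=
  invmx (A *m P *m A^t*) *m (A *m P *m B^t*).

Section Chart.
Variables (k n : nat) (A : 'M[C]_(k, n)) (B : 'M[C]_(n - k, n)).
Hypothesis fAB : frame A B.

Lemma chart_mulA (X : 'M[C]_(k, n - k)) : (A + X *m B) *m A^t* = 1%:M.
Proof.
have [AA _ AB _] := fAB; rewrite mulmxDl AA -mulmxA.
have -> : B *m A^t* = 0 by rewrite -[LHS]trmxCK adjmxM trmxCK AB trmx0 map_mx0.
by rewrite mulmx0 addr0.
Qed.

Lemma chart_mulB (X : 'M[C]_(k, n - k)) : (A + X *m B) *m B^t* = X.
Proof. by have [_ BB AB _] := fAB; rewrite mulmxDl AB -mulmxA BB mulmx1 add0r. Qed.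

Lemma chart_free (X : 'M[C]_(k, n - k)) : row_free (A + X *m B).
Proof. by apply/row_freeP; exists (A^t*); exact: chart_mulA. Qed.

Lemma orthproj_chart (X : 'M[C]_(k, n - k)) : orthproj k (chart_map A B X).
Proof. by have [] := orthproj_on (chart_free X). Qed.

Lemma chart_mapA (X : 'M[C]_(k, n - k)) :
  A *m chart_map A B X = invmx ((A + X *m B) *m (A + X *m B)^t*) *m (A + X *m B).
Proof.
rewrite /chart_map /proj_on !mulmxA.
by rewrite -[A *m _]trmxCK adjmxM trmxCK chart_mulA adjmx1 mul1mx.
Qed.

Lemma chart_map_unit (X : 'M[C]_(k, n - k)) : A *m chart_map A B X *m A^t* \in unitmx.
Proof.
by rewrite chart_mapA -mulmxA chart_mulA mulmx1 unitmx_inv unitmx_gram ?chart_free.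
Qed.

Lemma chart_mapK (X : 'M[C]_(k, n - k)) : chart_coord A B (chart_map A B X) = X.
Proof.
rewrite /chart_coord chart_mapA -!mulmxA chart_mulA chart_mulB mulmx1 invmxK mulmxA.
by rewrite mulmxV ?mul1mx // unitmx_gram ?chart_free.
Qed.

(** By uniqueness of the projector: for X the coordinate of [P], the rows of [A + X *m B] are
    combinations of those of [A *m P], hence lie in the row space of [P]. *)
Lemma chart_coordK (P : 'M[C]_n) : orthproj k P -> A *m P *m A^t* \in unitmx ->
  chart_map A B (chart_coord A B P) = P.
Proof.
move=> oP uP; apply/esym/orthproj_uniq => //; first exact: chart_free.
have -> : A + chart_coord A B P *m B = invmx (A *m P *m A^t*) *m (A *m P).
  have [_ _ _ E1] := fAB.
  rewrite -[X in _ = _ *m X]mulmx1 -E1 !mulmxDr; congr (_ + _).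
    by rewrite [A *m P *m (_ *m _)]mulmxA mulKmx.
  by rewrite /chart_coord -!mulmxA.
by rewrite mulmxA submxMl.
Qed.

End Chart.

(* [A P A^*] is the product of [A G^*] and its adjoint when [P = G^* G]. *)
Lemma compression_unit k n (A G : 'M[C]_(k, n)) :
  (A *m (G^t* *m G) *m A^t* \in unitmx) = (A *m G^t* \in unitmx).
Proof.
have -> : A *m (G^t* *m G) *m A^t* = (A *m G^t*) *m (A *m G^t*)^t*.
  by rewrite adjmxM trmxCK !mulmxA.
by rewrite unitmx_mul unitmx_adj andbb.
Qed.

(** In this form the condition to lie in a chart domain is affine in [G] inside a determinant, hence
    polynomial in graph coordinates. *)
Lemma compression_proj_on k n (A G : 'M[C]_(k, n)) : row_free G ->
  (A *m proj_on G *m A^t* \in unitmx) = (G *m A^t* \in unitmx).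
Proof.
move=> fG; have -> : A *m proj_on G *m A^t* =
    (G *m A^t*)^t* *m invmx (G *m G^t*) *m (G *m A^t*).
  by rewrite /proj_on adjmxM trmxCK !mulmxA.
by rewrite !unitmx_mul unitmx_adj unitmx_inv unitmx_gram // andbT andbb.
Qed.

(** Evaluation of polynomials is a ring morphism, so it commutes with the determinant. *)
Lemma det_pencil n (M N : 'M[C]_n) :
  exists p : {poly C}, forall s, p.[s] = \det (M + s *: N).
Proof.
exists (\det (map_mx polyC M + 'X *: map_mx polyC N)) => s.
rewrite -[_.[s]]/(horner_eval s _) -det_map_mx; congr (\det _).
apply/matrixP => i j; rewrite !mxE -[LHS]/(_.[s]).
by rewrite hornerD hornerM hornerX !hornerC.
Qed.

Lemma poly_nonroot_seq (p : {poly C}) (s : seq C) :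
  p != 0 -> uniq s -> (size p <= size s)%N -> exists2 a, a \in s & ~~ root p a.
Proof.
move=> p0 us ps; apply/hasP; rewrite has_predC; apply/negP => all_s.
by have := max_poly_roots p0 all_s us; rewrite ltnNge ps.
Qed.

(** With orthonormal bases G0 and G1 of the two ranges, the frame is sought on the line G0 + s (G1 -
    G0). Being in its chart is, for each projector, the nonvanishing of a polynomial in s; these
    take the value 1 at s = 0 and at s = 1 respectively, so their product is not zero. A good s
    exists, and orthonormalising does not change the chart domain. *)
Lemma common_frame k n (P0 P1 : 'M[C]_n) : orthproj k P0 -> orthproj k P1 ->
  exists (A : 'M[C]_(k, n)) B, [/\ frame A B, A *m P0 *m A^t* \in unitmx & A *m P1 *m A^t* \in unitmx].
Proof.
move=> /orthproj_gramP[G0 /unitarymxP uG0 ->] /orthproj_gramP[G1 /unitarymxP uG1 ->].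
have [p0 p0E] := det_pencil (G0 *m G0^t*) ((G1 - G0) *m G0^t*).
have [p1 p1E] := det_pencil (G0 *m G1^t*) ((G1 - G0) *m G1^t*).
have p01 : p0 * p1 != 0.
  rewrite mulf_neq0 //; apply/eqP => pE.
    by have := p0E 0; rewrite pE horner0 scale0r addr0 uG0 det1 => /esym/eqP; rewrite oner_eq0.
  have := p1E 1; rewrite pE horner0 scale1r -mulmxDl addrC subrK uG1 det1.
  by move=> /esym/eqP; rewrite oner_eq0.
(* Integers are distinct in characteristic zero, and there are more of them here than the degree. *)
have us : uniq [seq i%:R : C | i <- iota 0 (size (p0 * p1))].
  by rewrite map_inj_uniq ?iota_uniq // => i j /eqP; rewrite eqr_nat => /eqP.
have [|s _] := poly_nonroot_seq p01 us; first by rewrite size_map size_iota.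
rewrite rootM negb_or /root p0E p1E !scalemxAl -!mulmxDl -!unitfE -!unitmxE.
set A0 := G0 + _ => /andP[u0 u1].
have fA0 : row_free A0.
  by apply/row_freeP; exists (G0^t* *m invmx (A0 *m G0^t*)); rewrite mulmxA mulmxV.
have kn : (k <= n)%N by move: fA0 => /eqP <-; exact: rank_leq_col.
pose A := schmidt A0; have uA : A \is unitarymx by exact: schmidt_unitarymx.
have [B fAB] := frame_complete uA.
have /submxP[T AE] : (A <= A0)%MS by rewrite (eqmx_schmidt_free fA0).
have uT : T \in unitmx.
  rewrite -row_free_unit -row_leq_rank -{1}(mxrank_unitary uA) AE.
  exact: mxrankM_maxl.
by exists A, B; split=> //; rewrite compression_unit AE -mulmxA unitmx_mul uT.
Qed.

(** In the first chart the two projectors are joined by a complex line; on it the domain of the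
    second chart is the set of nonroots of [p]. *)
Lemma chart_pencil k n (A A' : 'M[C]_(k, n)) (B : 'M[C]_(n - k, n)) (P0 P1 : 'M[C]_n) :
  frame A B -> orthproj k P0 -> orthproj k P1 ->
  A *m P0 *m A^t* \in unitmx -> A *m P1 *m A^t* \in unitmx ->
  A' *m P0 *m A'^t* \in unitmx -> A' *m P1 *m A'^t* \in unitmx ->
  exists X0 X1 (p : {poly C}),
    [/\ chart_map A B X0 = P0, chart_map A B (X0 + 1 *: X1) = P1,
        p.[0] != 0, p.[1] != 0 &
        forall s, p.[s] != 0 ->
          A' *m chart_map A B (X0 + s *: X1) *m A'^t* \in unitmx].
Proof.
move=> fAB oP0 oP1 u0 u1 u0' u1'.
pose X0 := chart_coord A B P0; pose X1 := chart_coord A B P1 - X0.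
have XE0 : chart_map A B X0 = P0 by exact: chart_coordK.
have XE1 : chart_map A B (X0 + 1 *: X1) = P1.
  by rewrite scale1r addrC subrK; exact: chart_coordK.
have [p pE] := det_pencil ((A + X0 *m B) *m A'^t*) ((X1 *m B) *m A'^t*).
have pU s : (p.[s] != 0) = (A' *m chart_map A B (X0 + s *: X1) *m A'^t* \in unitmx).
  rewrite compression_proj_on ?chart_free // unitmxE unitfE pE.
  by rewrite scalemxAl -mulmxDl scalemxAl -addrA -mulmxDl.
exists X0, X1, p; split=> //; first by rewrite pU scale0r addr0 XE0.
- by rewrite pU XE1.
- by move=> s; rewrite pU.
Qed.

End OrthogonalProjectors.

(** * Filling a square in a linear space from its four sides *)

Section CoonsPatch.
Variables (R : pzRingType) (V : lmodType R).
Implicit Types (s t : R) (P o u v : V).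

(* The Coons patch with bottom side [P] (from [P0] to [P1]), constant top side
   [o], left side [u] and right side [v]. *)
Definition coons s t P P0 P1 o u v : V :=
  (1 - s) *: P + s *: o + (1 - t) *: u + t *: v -
  ((1 - s) *: ((1 - t) *: P0 + t *: P1) + s *: o).

Lemma coons_bottom t P P0 P1 o : coons 0 t P P0 P1 o P0 P1 = P.
Proof. by rewrite /coons subr0 !scale1r !scale0r !addr0 -(addrA P) addrK. Qed.

Lemma coons_top t P P0 P1 o : coons 1 t P P0 P1 o o o = o.
Proof.
rewrite /coons subrr !scale0r !scale1r !add0r scalerBl scale1r.
by rewrite -(addrA o) subrK addrK.
Qed.

Lemma coons_left s P0 P1 o u v : coons s 0 P0 P0 P1 o u v = u.
Proof. by rewrite /coons subr0 !scale0r !scale1r !addr0 addrAC subrr add0r. Qed.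

Lemma coons_right s P0 P1 o u v : coons s 1 P1 P0 P1 o u v = v.
Proof. by rewrite /coons subrr !scale0r !scale1r !add0r addr0 addrAC subrr add0r. Qed.

End CoonsPatch.

Lemma closed_setX (T U : topologicalType) (A : set T) (B : set U) :
  closed A -> closed B -> closed (A `*` B).
Proof.
move=> cA cB; have -> : A `*` B = fst @^-1` A `&` snd @^-1` B by [].
by apply: closedI; apply: preimage_closed => // x _; [exact: cvg_fst|exact: cvg_snd].
Qed.

Lemma continuous_fst_cst (U V : topologicalType) (b : V) :
  continuous (fun st : U * V => (st.1, b)).
Proof.
move=> x P [[A B] /= [nA nB] AB].
apply: (@filterS _ (nbhs x) _ (fst @^-1` A)) => [y Ay|].
  by apply: AB; split=> //=; exact: nbhs_singleton.
exact: (cvg_fst nA).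
Qed.

(** * Contracting a loop in a space covered by charts onto a matrix space *)

Section ChartCover.
Variable K : realType.
Local Notation C := K[i].
Local Notation I := [set t : K | 0 <= t <= 1].

Lemma cvg_within_image (U V : topologicalType) (A : set U) (B : set V) (f : U -> V) x :
  {for x, continuous f} -> (forall y, A y -> B (f y)) ->
  f @ within A (nbhs x) --> within B (nbhs (f x)).
Proof.
move=> cf AB P nP; change (nbhs x (fun y => A y -> P (f y))).
apply: (@filterS _ (nbhs x) _ (fun y => B (f y) -> P (f y))) => [y BP Ay|].
  exact/BP/AB.
exact: (cf (fun y => B y -> P y) nP).
Qed.

Variables (T : topologicalType) (S : set T) (p q : nat) (J : Type).
Variables (dom : J -> set T) (phi : J -> 'M[C]_(p, q) -> T) (psi : J -> T -> 'M[C]_(p, q)).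
Hypothesis dom_open : forall j, open (dom j).
Hypothesis phi_continuous : forall j, continuous (phi j).
Hypothesis phi_in : forall j X, S (phi j X) /\ dom j (phi j X).
Hypothesis psi_continuous : forall j x, dom j x -> {for x, continuous (psi j)}.
Hypothesis psiK : forall j x, S x -> dom j x -> phi j (psi j x) = x.
Hypothesis common_chart : forall x y, S x -> S y -> exists j, dom j x /\ dom j y.
Hypothesis chart_inter : forall j j' x y, S x -> S y -> dom j x -> dom j y ->
  dom j' x -> dom j' y -> exists g : K -> T, path_in (S `&` dom j `&` dom j') x y g.

Variables (x0 : T) (Sx0 : S x0) (l : K -> T) (lP : path_in S x0 x0 l).

Let lS t : I t -> S (l t).
Proof. by move=> It; case: lP => _ lS _ _; apply: lS; exists t. Qed.

Let l_continuous (t : K) (A : set K) : I t -> A `<=` I -> l @ within A (nbhs t) --> l t.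
Proof.
move=> It AI; case: lP => /subspace_continuousP /(_ t It) lc _ _ _.
by apply: cvg_trans lc; apply: cvg_app; exact: within_subset.
Qed.

(** The loop is contracted over [0, b] only. The edge over [b] is a path [g] from [l b] to [x0],
    along which the next piece is glued. *)
Definition partial_homotopy (b : K) (g : K -> T) : Prop :=
  exists H : K * K -> T,
    [/\ {within I `*` [set t | 0 <= t <= b], continuous H},
        forall s t, I s -> 0 <= t <= b -> S (H (s, t)),
        forall t, 0 <= t <= b -> H (0, t) = l t /\ H (1, t) = x0 &
        forall s, I s -> H (s, 0) = x0 /\ H (s, b) = g s].

(* The new square is filled in the chart by a Coons patch, which interpolates
   the four sides linearly. *)
Lemma partial_homotopy_step b b' j g g' : 0 <= b -> b < b' -> b' <= 1 ->
  (forall t, b <= t <= b' -> dom j (l t)) -> dom j x0 ->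
  partial_homotopy b g -> (forall s, I s -> dom j (g s)) ->
  path_in (S `&` dom j) (l b') x0 g' ->
  partial_homotopy b' g'.
Proof.
move=> b0 bb' b'1 ldom x0dom [H [cH HS Hlr Hbt]] gdom [cg' g'S g'0 g'1].
have g'in s : I s -> S (g' s) /\ dom j (g' s) by move=> Is; apply: g'S; exists s.
(* The sides of the new square in coordinates of chart [j]: the old edge [u], the new edge [v], the
   loop [P] and the base point [o]. The function [tau] rescales [b, b'] to [0, 1]. *)
pose u s := psi j (H (s, b)).
pose v s := psi j (g' s).
pose P t := psi j (l t).
pose o := psi j x0.
pose tau t := (t - b) / (b' - b).
pose c (x : K) : C := x%:C%C.
pose h (st : K * K) : 'M[C]_(p, q) :=
  coons (c st.1) (c (tau st.2)) (P st.2) (P b) (P b') o (u st.1) (v st.1).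
(* The two formulas agree over [b], where the patch returns to the old edge; both pieces live on
   closed strips, so the result is continuous. *)
pose H' st := if st.2 <= b then H st else phi j (h st).
have taub : tau b = 0 by rewrite /tau subrr mul0r.
have taub' : tau b' = 1 by rewrite /tau mulfV // subr_eq0 gt_eqF.
have c0 : c 0 = 0 by [].
have c1 : c 1 = 1 by [].
have bI : I b by rewrite /= b0 /= (le_trans (ltW bb')).
have b'I : I b' by rewrite /= (le_trans b0 (ltW bb')).
have I0 : I 0 by rewrite /= lexx ler01.
have I1 : I 1 by rewrite /= lexx ler01.
have bb : 0 <= b <= b by rewrite b0 lexx.
have Hb s : I s -> H (s, b) = g s by move=> /Hbt[].
have u0 : u 0 = P b by rewrite /u (Hlr b bb).1.
have u1 : u 1 = o by rewrite /u (Hlr b bb).2.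
have v0 : v 0 = P b' by rewrite /v g'0.
have v1 : v 1 = o by rewrite /v g'1.
have h0 t : h (0, t) = P t by rewrite /h /= u0 v0 c0 coons_bottom.
have h1 t : h (1, t) = o by rewrite /h /= u1 v1 c1 coons_top.
have hb s : h (s, b) = u s by rewrite /h /= taub c0 coons_left.
have hb' s : h (s, b') = v s by rewrite /h /= taub' c1 coons_right.
have phih s : I s -> phi j (h (s, b)) = H (s, b).
  move=> Is; rewrite hb /u psiK //; first by apply: HS => //; rewrite b0 lexx.
  by rewrite Hb //; exact: gdom.
exists H'; split.
- pose A1 := I `*` [set t : K | 0 <= t <= b].
  pose A2 := I `*` [set t : K | b <= t <= b'].
  have -> : I `*` [set t | 0 <= t <= b'] = A1 `|` A2.
    apply/seteqP; split=> [[s t] /= [Is /andP[t0 tb']]|[s t] /= [[Is]|[Is]] /= /andP[t0 tb]].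
    - by case: (leP t b) => tb; [left|right]; split=> //=; rewrite ?t0 ?tb ?tb' ?(ltW tb).
    - by split=> //=; rewrite t0 (le_trans tb (ltW bb')).
    - by split=> //=; rewrite tb (le_trans b0).
  have seg_closed (x y : K) : closed [set t : K | x <= t <= y].
    have -> : [set t : K | x <= t <= y] = `[x, y]%classic by apply/seteqP; split=> t /=; rewrite in_itv.
    exact: interval_closed.
  apply: withinU_continuous; [by apply: closed_setX; exact: seg_closed| by apply: closed_setX; exact: seg_closed| |].
    apply: (subspace_eq_continuous _ cH) => -[s t]; rewrite inE => -[/= Is /andP[_ tb]].
    by rewrite /from_subspace /H' /= tb.
  have ch : {within A2, continuous (phi j \o h)}.
    apply/subspace_continuousP => -[s t] [/= Is tbb'].
    have It : I t.
      by case/andP: tbb' => ? ?; rewrite /= (le_trans b0) // (le_trans _ b'1).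
    apply: (@cvg_comp _ _ _ h (phi j) _ (nbhs (h (s, t)))); last exact: phi_continuous.
    set F := within A2 (nbhs (s, t)).
    have FF : Filter F by exact: within_filter.
    have fs : (fun st : K * K => st.1) @ F --> s.
      by apply: cvg_within_filter; exact: cvg_fst.
    have ft : (fun st : K * K => st.2) @ F --> t.
      by apply: cvg_within_filter; exact: cvg_snd.
    have fc (f : K * K -> K) a : f @ F --> a -> (fun st => c (f st)) @ F --> c a.
      by move=> fa; apply: (cvg_comp _ _ fa); exact: continuous_real_complex.
    have ftau : (fun st : K * K => tau st.2) @ F --> tau t.
      by apply: cvgM; [apply: cvgB => //; exact: cvg_cst|exact: cvg_cst].
    have fP : (fun st : K * K => P st.2) @ F --> P t.
      apply: (@cvg_comp _ _ _ (fun st : K * K => l st.2) (psi j) _ (nbhs (l t))).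
        apply: (@cvg_comp _ _ _ snd l _ (within [set t | b <= t <= b'] (nbhs t))).
          by apply: cvg_within_image; [exact: cvg_snd|case=> ? ? []].
        apply: l_continuous => // y /= /andP[y0 y1].
        by rewrite (le_trans b0) // (le_trans _ b'1).
      by apply: psi_continuous; exact: ldom.
    have fu : (fun st : K * K => u st.1) @ F --> u s.
      apply: (@cvg_comp _ _ _ (fun st : K * K => H (st.1, b)) (psi j) _ (nbhs (H (s, b)))).
        move/subspace_continuousP : cH => cH.
        have := cH (s, b) (conj Is bb).
        apply: (@cvg_comp _ _ _ (fun st : K * K => (st.1, b)) H).
        apply: (@cvg_within_image _ _ A2 A1 (fun st : K * K => (st.1, b))).
          exact: continuous_fst_cst.
        by move=> [s' t'] [/= Is' _]; split.
      by apply: psi_continuous; rewrite Hb //; exact: gdom.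
    have fv : (fun st : K * K => v st.1) @ F --> v s.
      apply: (@cvg_comp _ _ _ (fun st : K * K => g' st.1) (psi j) _ (nbhs (g' s))).
        move/subspace_continuousP : cg' => cg'.
        have := cg' s Is; apply: (@cvg_comp _ _ _ fst g').
        by apply: cvg_within_image; [exact: cvg_fst|case=> ? ? []].
      by apply: psi_continuous; exact: (g'in s Is).2.
    have cs := fc _ _ fs; have ct := fc _ _ ftau.
    have cst (X : 'M[C]_(p, q)) : (fun st : K * K => X) @ F --> X by exact: cvg_cst.
    apply: cvgB.
      apply: (cvg_mxD _ (cvg_mxZ ct fv)).
      apply: (cvg_mxD _ (cvg_mxZ (cvg_1B ct) fu)).
      exact: (cvg_mxD (cvg_mxZ (cvg_1B cs) fP) (cvg_mxZ cs (cst o))).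
    apply: (cvg_mxD _ (cvg_mxZ cs (cst o))).
    apply: (cvg_mxZ (cvg_1B cs) _).
    exact: (cvg_mxD (cvg_mxZ (cvg_1B ct) (cst _)) (cvg_mxZ ct (cst _))).
  apply: (subspace_eq_continuous _ ch) => -[s t]; rewrite inE => -[/= Is /andP[bt _]].
  rewrite /from_subspace /H' /=; case: (leP t b) => // tb.
  have -> : t = b by apply/eqP; rewrite eq_le tb bt.
  exact: phih.
- move=> s t Is /andP[t0 tb']; rewrite /H' /=; case: leP => tb.
    by apply: HS => //; rewrite t0 tb.
  exact: (phi_in _ _).1.
- move=> t /andP[t0 tb']; rewrite /H' /=; case: leP => tb.
    by apply: Hlr; rewrite t0 tb.
  have It : I t by rewrite /= t0 (le_trans tb').
  rewrite h0 h1 !psiK //; first exact: lS.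
  by apply: ldom; rewrite (ltW tb).
- move=> s Is; rewrite /H' /= b0 leNgt bb' /= hb'; split; first exact: (Hbt s Is).1.
  by have [? ?] := g'in s Is; rewrite /v psiK.
Qed.

(** The quantification over all charts containing [x0] and [l b] makes the induction work: the last
    edge can be requested in the chart of the following step. *)
Definition reachable (b : K) : Prop :=
  forall j, dom j x0 -> dom j (l b) ->
  exists2 g, partial_homotopy b g & forall s, I s -> dom j (g s).

Lemma reachable0 : reachable 0.
Proof.
case: lP => _ _ l0 _.
move=> j j0 _; exists (fun=> x0); last by [].
exists (fun=> x0); split=> // [|t].
  by apply/continuous_subspaceT => x; exact: cvg_cst.
by rewrite -eq_le => /eqP <-.
Qed.

(** The edge over [b] is requested in [j], which covers the loop on [b, b']; the edge over [b'] is a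
    path in the intersection of [j] with the chart requested there. *)
Lemma reachable_step b b' j : 0 <= b -> b <= b' -> b' <= 1 ->
  (forall t, b <= t <= b' -> dom j (l t)) -> dom j x0 -> reachable b -> reachable b'.
Proof.
move=> b0; rewrite le_eqVlt => /predU1P[<- //|bb' b'1 ldom x0dom rb].
have [|g pg gdom] := rb j x0dom; first by apply: ldom; rewrite lexx ltW.
move=> j' j'0 j'b'; have b'I : I b' by rewrite /= (le_trans b0 (ltW bb')).
have [|g' [cg' g'S g'0 g'1]] := chart_inter (lS b'I) Sx0 _ x0dom j'b' j'0.
  by apply: ldom; rewrite lexx ltW.
exists g'; last by move=> s Is; have [] := g'S (g' s) (ex_intro2 _ _ s Is erefl).
apply: (partial_homotopy_step b0 bb' b'1 ldom x0dom pg gdom).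
by split=> // x /g'S[[]].
Qed.

Lemma chart_near t : I t -> exists j e, [/\ 0 < e, dom j x0 &
  forall t', I t' -> `|t - t'| < e -> dom j (l t')].
Proof.
move=> It; have [j [jx0 jt]] := common_chart Sx0 (lS It).
have : (l @ within I (nbhs t)) (dom j).
  by apply: (l_continuous It) => //; exact: open_nbhs_nbhs.
rewrite /within /= => /nbhs_ballP[e e0 he]; exists j, e; split=> //.
by move=> t' It' tt'; exact: he.
Qed.

(** [G] collects the parameters up to which everything is reachable. A chart shared by [x0] and the
    loop point at sup G covers the loop near that point, and a single step from an element of [G]
    close to sup G passes beyond it, unless sup G = 1. *)
Lemma reachable_all b : I b -> reachable b.
Proof.
pose G := [set b | I b /\ forall b', 0 <= b' <= b -> reachable b'].
have G0 : G 0.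
  split; first by rewrite /= lexx ler01.
  by move=> b'; rewrite -eq_le => /eqP <-; exact: reachable0.
have G_sup : has_sup G by split; [exists 0|exists 1 => b' [] /andP[]].
have s0 : 0 <= sup G by exact: ub_le_sup G_sup.2 _ G0.
have s1 : sup G <= 1 by apply: ge_sup; [exists 0|move=> b' [/andP[]]].
have [j [e [e0 jx0 hj]]] : exists j e, [/\ 0 < e, dom j x0 &
    forall t', I t' -> `|sup G - t'| < e -> dom j (l t')].
  by apply: chart_near; rewrite /= s0.
have [b1 Gb1 sb1] := sup_adherent e0 G_sup.
have b1s : b1 <= sup G by exact: ub_le_sup G_sup.2 _ Gb1.
have [/andP[b10 b11] rb1] := Gb1.
have Gm b' : b1 <= b' -> b' < sup G + e -> b' <= 1 -> reachable b'.
  move=> b1b' b's b'1; apply: (@reachable_step b1 b' j) => //; last first.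
    by apply: rb1; rewrite b10 lexx.
  move=> t /andP[b1t tb']; apply: hj.
    by rewrite /= (le_trans b10) // (le_trans tb').
  by rewrite ltr_distlC; apply/andP; split; [apply: lt_le_trans b1t|apply: le_lt_trans b's].
(* The point e/2 beyond sup G, cut off at 1. It belongs to [G], so the cut-off must be active. *)
pose m := Num.min 1 (sup G + e / 2).
have m1 : m <= 1 by rewrite ge_min lexx.
have ms : m < sup G + e.
  by rewrite gt_min; apply/orP; right; rewrite ltrD2l ltr_pdivrMr // ltr_pMr // ltr1n.
have b1m : b1 <= m by rewrite le_min b11 (le_trans b1s) // lerDl divr_ge0 // ltW.
have m0 : 0 <= m by exact: le_trans b1m.
have Gmm : G m.
  split; first by rewrite /= m0.
  move=> b' /andP[b'0 b'm]; case: (leP b1 b') => [h|/ltW h].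
    by apply: Gm => //; [exact: le_lt_trans ms|exact: le_trans m1].
  by apply: rb1; rewrite b'0.
have msup : m <= sup G by exact: ub_le_sup G_sup.2 _ Gmm.
have mE : m = 1.
  move: msup; rewrite /m; case: (leP 1 (sup G + e / 2)) => // _.
  by rewrite gerDl leNgt divr_gt0.
by move=> Ib; apply: Gmm.2; rewrite mE.
Qed.

(** A partial homotopy over [0, 1] with constant last edge is a null homotopy. Since the loop ends
    at [x0], the constant path is a legitimate last edge. *)
Lemma chart_cover_null_homotopic : null_homotopic S x0 l.
Proof.
have I1 : I 1 by rewrite /= ler01 lexx.
case: (lP) => _ _ l0 l1.
have [j [e [e0 jx0 hj]]] := chart_near I1.
(* The last step starts within [e] of 1; the maximum keeps its start in [0, 1] when [e] is large. *)
pose b := Num.max 0 (1 - e / 2).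
have b0 : 0 <= b by rewrite le_max lexx.
have b1 : b < 1 by rewrite gt_max ltr01 gtrBl divr_gt0.
have be : 1 - e < b.
  by rewrite lt_max; apply/orP; right; rewrite ltrD2l ltrN2 ltr_pdivrMr // ltr_pMr // ltr1n.
have ldom t : b <= t <= 1 -> dom j (l t).
  move=> /andP[bt t1]; apply: hj; first by rewrite /= t1 (le_trans b0).
  rewrite ltr_distlC (lt_le_trans be bt) /=.
  by rewrite (le_lt_trans t1) // ltrDl.
have Ib : I b by rewrite /= b0 ltW.
have [|g pg gdom] := reachable_all Ib jx0; first by apply: ldom; rewrite lexx ltW.
have [|H [cH HS Hlr Hbt]] := partial_homotopy_step (g' := fun=> x0) b0 b1 (lexx 1) ldom jx0 pg gdom.
  split=> //.
  - by apply/continuous_subspaceT => x; exact: cvg_cst.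
  - by move=> x [t _ <-].
exists H; split=> //.
by move=> x [[s t] [Is It] <-]; exact: HS.
Qed.

End ChartCover.

(** * Topology of the set of orthogonal projectors of rank k *)

Section ProjectorTopology.
Variables (K : realType) (k n : nat).
Local Open Scope sesquilinear_scope.
Local Notation C := K[i].
Local Notation I := [set t : K | 0 <= t <= 1].
Local Notation Proj := [set P : 'M[C]_n | orthproj k P].

Lemma cvg_chart_map (T : topologicalType) (F : set_system T) (FF : Filter F)
    (A : 'M[C]_(k, n)) B (f : T -> 'M[C]_(k, n - k)) (X : 'M[C]_(k, n - k)) :
  frame A B -> f @ F --> X ->
  (fun x => chart_map A B (f x)) @ F --> chart_map A B X.
Proof.
move=> fAB fX.
have cG : (fun x => A + f x *m B) @ F --> A + X *m B.
  apply: cvg_mxD; first exact: cvg_cst.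
  by apply: (cvg_mxM fX); exact: cvg_cst.
apply: (cvg_mxM _ cG); apply: (cvg_mxM (cvg_mxadj cG)).
apply: cvg_mxinv; first exact/unitmx_gram/chart_free.
exact: (cvg_mxM cG (cvg_mxadj cG)).
Qed.

Lemma cvg_chart_coord (T : topologicalType) (F : set_system T) (FF : Filter F)
    (A : 'M[C]_(k, n)) (B : 'M[C]_(n - k, n)) (f : T -> 'M[C]_n) (P : 'M[C]_n) :
  A *m P *m A^t* \in unitmx -> f @ F --> P ->
  (fun x => chart_coord A B (f x)) @ F --> chart_coord A B P.
Proof.
move=> uP fP.
have cAP : (fun x => A *m f x) @ F --> A *m P.
  by apply: (cvg_mxM _ fP); exact: cvg_cst.
apply: cvg_mxM; last by apply: (cvg_mxM cAP); exact: cvg_cst.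
by apply: (cvg_mxinv uP); apply: (cvg_mxM cAP); exact: cvg_cst.
Qed.

Lemma open_compression_unit (A : 'M[C]_(k, n)) :
  open [set P : 'M[C]_n | A *m P *m A^t* \in unitmx].
Proof.
rewrite openE => P /= uP.
have cP : (fun Q : 'M[C]_n => \det (A *m Q *m A^t*)) @ nbhs P --> \det (A *m P *m A^t*).
  apply: cvg_det; apply: cvg_mxM; last exact: cvg_cst.
  by apply: cvg_mxM; [exact: cvg_cst|exact: cvg_id].
have d0 : \det (A *m P *m A^t*) != 0 by rewrite -unitfE -unitmxE.
by apply: filterS (cvgr_neq0 _ cP d0) => Q; rewrite /= unitmxE unitfE.
Qed.

(* These arcs from 0 to 1 are pairwise disjoint apart from their end points, so
   each root of a polynomial lies on at most one of them. *)
Definition arc (c : nat) (t : K) : C := Complex t (c%:R * (t * (1 - t))).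

Lemma arc_inj c c' t t' : 0 < t < 1 -> arc c t = arc c' t' -> c = c'.
Proof.
move=> /andP[t0 t1] [tt']; rewrite -tt' => /mulIf E.
by apply/eqP; rewrite -(@eqr_nat K) E // mulf_neq0 // ?gt_eqF // subr_gt0.
Qed.

(** If every arc met a root, it would do so strictly between its end points, where the arcs are
    disjoint, and [p] would have more roots than its degree allows. *)
Lemma arc_avoids_roots (p : {poly C}) : p.[0] != 0 -> p.[1] != 0 ->
  exists c, forall t, I t -> p.[arc c t] != 0.
Proof.
move=> p0 p1; apply: contrapT => nex.
have bad c : exists t, 0 < t < 1 /\ root p (arc c t).
  apply: contrapT => nbad; apply: nex; exists c => t /= /andP[t0 t1].
  apply/negP => rt; apply: nbad; exists t; split; last exact: rt.
  have arc0 : arc c 0 = 0 by rewrite /arc mul0r mulr0.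
  have arc1 : arc c 1 = 1 by rewrite /arc subrr !mulr0.
  rewrite !lt_neqAle t0 t1 !andbT; apply/andP; split.
    by apply: contra_neq p0 => tE; move/eqP: rt; rewrite -tE arc0.
  by apply: contra_neq p1 => tE; move/eqP: rt; rewrite tE arc1.
have [f fP] := choice bad.
have pn0 : p != 0 by apply: contra_neq p0 => ->; rewrite horner0.
have us : uniq [seq arc c (f c) | c <- iota 0 (size p)].
  rewrite map_inj_uniq ?iota_uniq // => c c'; exact/arc_inj/(fP c).1.
have [|a /mapP[c _ ->]] := poly_nonroot_seq pn0 us; first by rewrite size_map size_iota.
by rewrite (fP c).2.
Qed.

Lemma continuous_arc c : continuous (arc c).
Proof.
move=> t.
have aE : arc c = fun t => t%:C%C + (c%:R * (t * (1 - t)))%:C%C * 'i%C.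
  by apply/funext => x; rewrite /arc; simpc.
rewrite aE; apply: cvgD; first exact: continuous_real_complex.
apply: cvgM; last exact: cvg_cst.
apply: (cvg_comp (fun t => c%:R * (t * (1 - t))) (fun x : K => x%:C%C : C)); last exact: continuous_real_complex.
apply: cvgM; first exact: cvg_cst.
by apply: cvgM; [exact: cvg_id|apply: cvgB; [exact: cvg_cst|exact: cvg_id]].
Qed.

(** The path is an arc in the complex line of [chart_pencil]: it stays in the first chart by
    construction, and in the second one by avoiding the roots of [p]. *)
Lemma projector_chart_inter (A A' : 'M[C]_(k, n)) (B B' : 'M[C]_(n - k, n)) P0 P1 :
  frame A B -> frame A' B' -> Proj P0 -> Proj P1 ->
  A *m P0 *m A^t* \in unitmx -> A *m P1 *m A^t* \in unitmx ->
  A' *m P0 *m A'^t* \in unitmx -> A' *m P1 *m A'^t* \in unitmx ->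
  exists g : K -> 'M[C]_n,
    path_in (Proj `&` [set P | A *m P *m A^t* \in unitmx]
                  `&` [set P | A' *m P *m A'^t* \in unitmx]) P0 P1 g.
Proof.
move=> fAB fAB' oP0 oP1 u0 u1 u0' u1'.
have [X0 [X1 [p [XE0 XE1 p0 p1 pU]]]] := chart_pencil fAB oP0 oP1 u0 u1 u0' u1'.
have [c cP] := arc_avoids_roots p0 p1.
exists (fun t => chart_map A B (X0 + arc c t *: X1)); split.
- apply: continuous_subspaceT => t; apply: cvg_chart_map => //.
  apply: cvg_mxD; first exact: cvg_cst.
  by apply: cvg_mxZ; [exact: continuous_arc|exact: cvg_cst].
- move=> _ [t It <-]; split; last exact: pU (cP t It).
  by split; [exact: orthproj_chart|exact: chart_map_unit].
- have -> : arc c 0 = 0 by rewrite /arc mul0r mulr0.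
  by rewrite scale0r addr0.
- have -> : arc c 1 = 1 by rewrite /arc subrr !mulr0.
  exact: XE1.
Qed.

Lemma projector_path P0 P1 : Proj P0 -> Proj P1 ->
  exists g : K -> 'M[C]_n, path_in Proj P0 P1 g.
Proof.
move=> oP0 oP1; have [A [B [fAB u0 u1]]] := common_frame oP0 oP1.
have [g [cg gS g0 g1]] := projector_chart_inter fAB fAB oP0 oP1 u0 u1 u0 u1.
by exists g; split=> // x /gS[[]].
Qed.

Lemma projector_null_homotopic P0 (l : K -> 'M[C]_n) :
  Proj P0 -> path_in Proj P0 P0 l -> null_homotopic Proj P0 l.
Proof.
move=> oP0 lP.
pose J := {AB : 'M[C]_(k, n) * 'M[C]_(n - k, n) | frame AB.1 AB.2}.
pose dom (j : J) := [set P : 'M[C]_n | (sval j).1 *m P *m (sval j).1^t* \in unitmx].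
pose phi (j : J) := chart_map (sval j).1 (sval j).2.
pose psi (j : J) := chart_coord (sval j).1 (sval j).2.
apply: (@chart_cover_null_homotopic K _ Proj _ _ J dom phi psi).
- by move=> j; exact: open_compression_unit.
- by move=> [[A B] /= fAB] X; exact: (@cvg_chart_map _ (nbhs X) _ A B id X fAB cvg_id).
- move=> [[A B] /= fAB] X; split; first exact: orthproj_chart.
  exact: chart_map_unit.
- by move=> [[A B] /= fAB] P uP; exact: (@cvg_chart_coord _ (nbhs P) _ A B id P uP cvg_id).
- by move=> [[A B] /= fAB] P oP uP; exact: chart_coordK.
- move=> P Q oP oQ; have [A [B [fAB uP uQ]]] := common_frame oP oQ.
  have fAB' : frame (A, B).1 (A, B).2 by exact: fAB.
  exists (exist (fun AB => frame AB.1 AB.2) (A, B) fAB').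
  by split; [exact: uP|exact: uQ].
- move=> [[A B] /= fAB] [[A' B'] /= fAB'] P Q oP oQ uP uQ uP' uQ'.
  exact: (projector_chart_inter fAB fAB' oP oQ uP uQ uP' uQ').
- exact: oP0.
- exact: lP.
Qed.

Lemma projector_nonempty : (k <= n)%N -> Proj !=set0.
Proof.
move=> kn; exists (proj_on (pid_mx k : 'M[C]_(k, n))).
by apply: (orthproj_on _).1; rewrite /row_free rank_pid_mx.
Qed.

(** The rank is not continuous, but for self-adjoint idempotents it is prescribed by the trace,
    which is. The trace equation is put into a 1 x 1 matrix so that the criterion [cE] covers it. *)
Lemma projector_closed : closed Proj.
Proof.
have cE m (f : 'M[C]_n -> 'M[C]_m) : continuous f -> closed [set P | f P = 0].
  move=> cf; have -> : [set P | f P = 0] = f @^-1` [set 0] by [].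
  by apply: preimage_closed => [x _|]; [exact: cf|exact/accessible_closed_set1/hausdorff_accessible/norm_hausdorff].
have -> : Proj = [set P : 'M[C]_n | P *m P - P = 0] `&` [set P | P^t* - P = 0] `&`
    [set P | (\tr P - k%:R)%:M = 0 :> 'M[C]_1].
  apply/seteqP; split=> [P oP|P [[/= /subr0_eq PP /subr0_eq Pa] trP]].
    have [PP Pa _] := oP.
    by rewrite /setI /= PP Pa !subrr (orthproj_trace oP) subrr raddf0.
  split=> //; apply/eqP; rewrite -(@eqr_nat C) -(@orthproj_trace C (\rank P) n P) //.
  by have /matrixP /(_ 0 0) /eqP := trP; rewrite mxE mxE /= mulr1n subr_eq0.
have cid (x : 'M[C]_n) : id @ nbhs x --> x by exact: cvg_id.
apply: closedI; first apply: closedI.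
- by apply: cE => x; apply: (cvgB (cvg_mxM (cid x) (cid x)) (cid x)).
- by apply: cE => x; apply: (cvgB (cvg_mxadj (cid x)) (cid x)).
apply: cE => x; apply: (@cvg_mx K _ 1 1 (nbhs x) _) => i j; rewrite mxE.
under eq_fun do rewrite mxE.
case: (i == j); last by rewrite !mulr0n; exact: cvg_cst.
rewrite !mulr1n; apply: cvgB; last exact: cvg_cst.
apply: cvg_big => [|a _]; first exact: add_continuous.
exact: coord_continuous.
Qed.

Lemma complex_le1 (z : C) : `|z| <= 1 ->
  -1 <= complex.Re z <= 1 /\ -1 <= complex.Im z <= 1.
Proof.
move=> z1; have : (complex.Re z ^+ 2 + complex.Im z ^+ 2)%:C%C <= 1%:C%C.
  by rewrite add_Re2_Im2 expr_le1.
rewrite lecR => h.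
have sq (a b : K) : a ^+ 2 + b ^+ 2 <= 1 -> -1 <= a <= 1.
  move=> ab; rewrite -ler_norml -(@expr_le1 _ 2) // real_normK ?num_real //.
  by apply: le_trans ab; rewrite lerDl sqr_ge0.
by split; [exact: sq h|move: h; rewrite addrC => /sq].
Qed.

(** The set is a square containing the unit disc; as such it is the continuous image of a product of
    two real segments. *)
Lemma disc_compact : compact [set z : C | -1 <= complex.Re z <= 1 /\ -1 <= complex.Im z <= 1].
Proof.
pose f (x : K * K) : C := x.1%:C%C + x.2%:C%C * 'i%C.
have cf : continuous f.
  move=> x; apply: cvgD.
    by apply: (cvg_comp fst (fun x : K => x%:C%C : C)); [exact: cvg_fst|exact: continuous_real_complex].
  apply: cvgM; last exact: cvg_cst.
  by apply: (cvg_comp snd (fun x : K => x%:C%C : C)); [exact: cvg_snd|exact: continuous_real_complex].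
have -> : [set z : C | -1 <= complex.Re z <= 1 /\ -1 <= complex.Im z <= 1] =
    f @` (`[-1, 1]%classic `*` `[-1, 1]%classic).
  apply/seteqP; split=> [[a b] /= ab|_ [[a b] /= ab <-]].
    by exists (a, b); rewrite /= ?in_itv //= /f /=; simpc.
  by move: ab; rewrite /= !in_itv /f /=; simpc.
apply: continuous_compact; first exact: continuous_subspaceT.
by apply: compact_setX; exact: segment_compact.
Qed.

(** A closed set of matrices with entries in a compact square; reshaping matrices into rows gives
    access to compactness of products. *)
Lemma projector_compact : compact Proj.
Proof.
pose D := [set z : C | -1 <= complex.Re z <= 1 /\ -1 <= complex.Im z <= 1].
pose B := [set v : 'rV[C]_(n * n) | forall i, D (v ord0 i)].
have cB : compact B by exact: (@rV_compact C _ (fun=> D) (fun=> disc_compact)).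
have cv : continuous (vec_mx : 'rV[C]_(n * n) -> 'M[C]_n).
  move=> v; apply: (@cvg_mx K _ n n (nbhs v) _) => i j; rewrite mxE.
  under eq_fun do rewrite mxE.
  exact: coord_continuous.
have cvB : compact (vec_mx @` B) by apply: continuous_compact => //; exact: continuous_subspaceT.
apply: (subclosed_compact projector_closed cvB) => P oP.
exists (mxvec P); last by rewrite mxvecK.
move=> a; case/mxvec_indexP: a => i j; rewrite mxvecE.
exact: (complex_le1 (orthproj_entry_le1 i j oP)).
Qed.

End ProjectorTopology.

(** * Subspaces and the projectors onto them *)

Section RowSpace.
Variable K : realType.
Local Notation C := K[i].

Lemma mem_row_space k z (X : 'M[C]_(k, z)) v : (v \in row_space X) = (v <= X)%MS.
Proof.
apply/idP/idP => [/coord_span -> |/submxP[D ->]].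
  apply: summx_sub => i _; apply: scalemx_sub.
  by rewrite -tnth_nth tnth_mktuple row_sub.
rewrite mulmx_sum_row; apply: rpred_sum => i _; apply: memvZ; apply: memv_span.
by apply/tnthP; exists i; rewrite tnth_mktuple.
Qed.

Lemma eq_row_space k l z (X : 'M[C]_(k, z)) (Y : 'M[C]_(l, z)) :
  (X :=: Y)%MS -> row_space X = row_space Y.
Proof. by move=> XY; apply/vspaceP => v; rewrite !mem_row_space XY. Qed.

Lemma dim_row_space k z (X : 'M[C]_(k, z)) : \dim (row_space X) = \rank X.
Proof.
rewrite -(eq_row_space (eq_row_base X)).
have : free [tuple row i (row_base X) | i < \rank X].
  apply/freeP => c cX i.
  have : (\row_j c j) *m row_base X = 0.
    rewrite mulmx_sum_row -[RHS]cX; apply: eq_bigr => j _.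
    by rewrite mxE -tnth_nth tnth_mktuple.
  move=> /eqP; rewrite -[X in _ == X](mul0mx _ (row_base X)).
  rewrite (inj_eq (row_free_inj (row_base_free X))) => /eqP /matrixP /(_ 0 i).
  by rewrite !mxE.
by rewrite /free size_tuple => /eqP.
Qed.

(** The inverse of [row_space] on orthogonal projectors. The basis is arbitrary, as the projector
    depends on its span only. *)
Definition proj_of z (U : {vspace 'rV[C]_z}) : 'M[C]_z :=
  proj_on (\matrix_(i < \dim U) (vbasis U)`_i).

Lemma proj_of_basis z (U : {vspace 'rV[C]_z}) :
  row_space (\matrix_(i < \dim U) (vbasis U)`_i) = U.
Proof.
rewrite /row_space; apply: (etrans _ (span_basis (vbasisP U))); congr (span _).
apply: (@eq_from_nth _ 0) => [|i]; rewrite !size_tuple // => ib.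
have := tnth_mktuple (fun i => row i (\matrix_(i < \dim U) (vbasis U)`_i)) (Ordinal ib).
by rewrite (tnth_nth 0) rowK.
Qed.

Lemma proj_of_free z (U : {vspace 'rV[C]_z}) :
  row_free (\matrix_(i < \dim U) (vbasis U)`_i).
Proof. by rewrite /row_free -dim_row_space proj_of_basis. Qed.

Lemma orthproj_proj_of z (U : {vspace 'rV[C]_z}) : orthproj (\dim U) (proj_of U).
Proof. by have [] := orthproj_on (proj_of_free U). Qed.

Lemma row_space_proj_of z (U : {vspace 'rV[C]_z}) : row_space (proj_of U) = U.
Proof.
have [_ eqU] := orthproj_on (proj_of_free U).
by rewrite (eq_row_space eqU) proj_of_basis.
Qed.

Lemma orthproj_row_space k z (P Q : 'M[C]_z) : orthproj k P -> orthproj k Q ->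
  row_space P = row_space Q -> P = Q.
Proof.
move=> oP oQ PQ.
have [G uG QE] := orthproj_gramP oQ.
have fG : row_free G by rewrite /row_free mxrank_unitary.
have [_ eqG] := orthproj_on fG.
have QG : Q = proj_on G by rewrite QE /proj_on (unitarymxP uG) invmx1 mulmx1.
rewrite QG; apply: orthproj_uniq oP fG _.
apply/row_subP => i; rewrite -mem_row_space PQ mem_row_space QG eqG.
exact: row_sub.
Qed.

Lemma proj_of_row_space k z (P : 'M[C]_z) : orthproj k P -> proj_of (row_space P) = P.
Proof.
move=> oP; have [_ _ rP] := oP.
apply: (@orthproj_row_space k) => //; last exact: row_space_proj_of.
by have := orthproj_proj_of (row_space P); rewrite dim_row_space rP.
Qed.

End RowSpace.

(** * The exponential on the imaginary axis and on combinations of idempotents *)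

Section Exponential.
Variable K : realType.
Local Notation C := K[i].

Definition expi (t : K) : C := Complex (cos t) (sin t).

(** The parity factors are those of the cosine and sine series, so that these series can be
    recognised term by term. *)
Lemma imaginary_exp k :
  ('i%C : C) ^+ k = ((~~ odd k)%:R * (-1) ^+ k./2)%:C%C +
                    ((odd k)%:R * (-1) ^+ k.-1./2)%:C%C * 'i%C.
Proof.
rewrite -{1}(odd_double_half k) exprD -mul2n exprM sqr_i.
have sgnE m : (-1) ^+ m = ((-1) ^+ m)%:C%C :> C by rewrite rmorphXn rmorphN1.
case kodd: (odd k) => /=; last by rewrite expr0 !mul1r mul0r rmorph0 mul0r addr0 sgnE.
rewrite expr1 mul0r rmorph0 add0r mul1r mulrC sgnE; congr (((-1) ^+ _)%:C%C * _).
by case: k kodd => //= k; rewrite uphalf_half => /negbTE ->.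
Qed.

Lemma exp_imaginary_cvg (t : K) :
  series (fun k : nat => (k`!%:R : C)^-1 * (Complex 0 t) ^+ k) @ \oo --> expi t.
Proof.
have tE : Complex 0 t = t%:C%C * 'i%C :> C by simpc.
have -> : series (fun k : nat => (k`!%:R : C)^-1 * (Complex 0 t) ^+ k) =
    fun N => (series (cos_coeff t) N)%:C%C + (series (sin_coeff t) N)%:C%C * 'i%C.
  apply/funext => N; rewrite /series /= !rmorph_sum /= mulr_suml -big_split /=.
  apply: eq_bigr => k _; rewrite tE exprMn imaginary_exp.
  have -> : (k`!%:R : C)^-1 = ((k`!%:R)^-1)%:C%C by rewrite fmorphV rmorph_nat.
  have -> : (t%:C%C : C) ^+ k = (t ^+ k)%:C%C by rewrite rmorphXn.
  rewrite !mulrDr; congr (_ + _).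
    by rewrite -!rmorphM; congr (_%:C%C); rewrite /cos_coeff /= -exprnP; ring.
  by rewrite !mulrA -!rmorphM; congr (_%:C%C * _); rewrite /sin_coeff /=; ring.
have -> : expi t = (cos t)%:C%C + (sin t)%:C%C * 'i%C by rewrite /expi; simpc.
have cc : series (cos_coeff t) @ \oo --> cos t.
  by rewrite unlock; exact: is_cvg_series_cos_coeff.
have cs : series (sin_coeff t) @ \oo --> sin t.
  by rewrite unlock; exact: is_cvg_series_sin_coeff.
apply: cvgD.
  by apply: (cvg_comp _ (fun x : K => x%:C%C : C) cc); exact: continuous_real_complex.
apply: cvgM; last exact: cvg_cst.
by apply: (cvg_comp _ (fun x : K => x%:C%C : C) cs); exact: continuous_real_complex.
Qed.

(** Powers act on the coefficients only, so each partial sum of the exponential is a combination of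
    the [F i] with scalar partial sums. *)
Lemma expmx_idempotents n (J : finType) (F : J -> 'M[C]_n) (t : J -> K) :
  (forall i j, F i *m F j = if i == j then F i else 0) -> \sum_i F i = 1%:M ->
  expmx (\sum_i Complex 0 (t i) *: F i) = \sum_i expi (t i) *: F i.
Proof.
move=> FF F1; set L := \sum_i _.
have LX k : L ^+ k = \sum_i (Complex 0 (t i)) ^+ k *: F i.
  elim: k => [|k IH]; first by rewrite expr0 -idmxE -F1; apply: eq_bigr => i _; rewrite expr0 scale1r.
  rewrite exprS IH -mulmxE mulmx_suml; apply: eq_bigr => i _.
  rewrite mulmx_sumr (bigD1 i) //= -scalemxAl -scalemxAr FF eqxx scalerA -exprS.
  rewrite big1 ?addr0 // => j ji.
  by rewrite -scalemxAl -scalemxAr FF eq_sym (negbTE ji) !scaler0.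
rewrite /expmx.
have -> : series (fun k : nat => (k`!%:R : C)^-1 *: L ^+ k) = fun N =>
    \sum_i series (fun k : nat => (k`!%:R : C)^-1 * (Complex 0 (t i)) ^+ k) N *: F i.
  apply/funext => N; rewrite /series /=.
  under [RHS]eq_bigr do rewrite scaler_suml.
  rewrite exchange_big /=; apply: eq_bigr => k _.
  by rewrite LX scaler_sumr; apply: eq_bigr => i _; rewrite scalerA.
apply: cvg_lim; first exact: norm_hausdorff.
apply: cvg_big => [|i _]; first exact: add_continuous.
by apply: cvg_mxZ; [exact: exp_imaginary_cvg|exact: cvg_cst].
Qed.

Lemma expi_surj (z : C) : `|z| = 1 -> exists2 t, - pi < t <= pi & expi t = z.
Proof.
case: z => a b zn.
have ab : a ^+ 2 + b ^+ 2 = 1.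
  have := add_Re2_Im2 (Complex a b); rewrite zn expr1n /=; by case.
have a1 : -1 <= a <= 1.
  rewrite -ler_norml -(@expr_le1 _ 2) // real_normK ?num_real //.
  by rewrite -ab lerDl sqr_ge0.
have s2 : 1 - a ^+ 2 = b ^+ 2 by rewrite -ab addrAC subrr add0r.
have ca : cos (acos a) = a by apply: acosK; rewrite in_itv.
have sa : sin (acos a) = `|b| by rewrite sin_acos // s2 sqrtr_sqr.
have p0 := pi_gt0 K.
case: (leP 0 b) => b0.
  exists (acos a); last by rewrite /expi ca sa ger0_norm.
  by rewrite acos_lepi // (lt_le_trans _ (acos_ge0 a1)) // oppr_lt0.
exists (- acos a); last by rewrite /expi cosN sinN ca sa ltr0_norm // opprK.
(* Here [b] is negative, so [a] is not -1 and the angle [- acos a] stays strictly above -pi. *)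
have aN1 : -1 < a.
  rewrite lt_neqAle (andP a1).1 andbT; apply/negP => /eqP aE.
  by move: s2; rewrite -aE sqrrN expr1n subrr => /esym/eqP; rewrite sqrf_eq0 lt_eqF.
rewrite ltrN2 acos_ltpi ?aN1 ?(andP a1).2 //=.
by rewrite (le_trans _ (ltW p0)) // oppr_le0 acos_ge0.
Qed.

(** The angle [s] of a logarithm may be -pi, the normalised angle [t] may not. Half their difference
    has sine zero and lies in (-pi, pi], so it is 0 or pi, and the latter only occurs at the two
    ends. *)
Lemma expi_eq (s t : K) : - pi <= s <= pi -> - pi < t <= pi -> expi s = expi t ->
  s = t \/ s = - pi /\ t = pi.
Proof.
move=> /andP[s0 s1] /andP[t0 t1] [cst sst].
have p0 := pi_gt0 K.
have cd : cos (s - t) = 1 by rewrite cosB cst sst -!expr2 cos2Dsin2.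
pose d := (t - s) / 2.
have dE : t - s = d *+ 2 by rewrite /d -mulr_natr mulfVK.
have sd : sin d = 0.
  have : cos (d *+ 2) = 1 by rewrite -dE -opprB cosN.
  rewrite cos_mulr2n mulr2n => h.
  have c2 : cos d ^+ 2 = 1 by lra.
  have := cos2Dsin2 d; rewrite c2 => /eqP.
  by rewrite -subr_eq0 addrAC subrr add0r sqrf_eq0 => /eqP.
have d1 : d <= pi.
  by rewrite /d ler_pdivrMr // mulr_natr mulr2n lerD // lerNl.
have dN1 : - pi < d.
  by rewrite /d ltr_pdivlMr // mulr_natr mulr2n ltr_leD // lerN2.
have [d0|d0|d0] := ltgtP d 0.
- have : 0 < sin (- d) by apply: sin_gt0_pi; rewrite oppr_gt0 d0 ltrNl dN1.
  by rewrite sinN sd oppr0 ltxx.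
- move: d1; rewrite le_eqVlt => /predU1P[dpi|dpi].
    right; have tsE : t - s = pi + pi by rewrite dE dpi mulr2n.
    have tE : t = pi.
      apply/eqP; rewrite eq_le t1 /= -(lerD2r (- s)) tsE.
      by rewrite lerD2l lerNl.
    by split=> //; move: tsE; rewrite tE => /addrI <-; rewrite opprK.
  by have := @sin_gt0_pi K d; rewrite d0 dpi sd ltxx => /(_ isT).
- left; apply/esym/eqP; rewrite -subr_eq0 dE d0 mul0rn //.
Qed.

Lemma expi_pi : expi pi = -1.
Proof. by rewrite /expi cospi sinpi; apply/eqP; rewrite eq_complex /= oppr0 !eqxx. Qed.

Lemma expiNpi : expi (- pi) = -1.
Proof. by rewrite /expi cosN sinN cospi sinpi; apply/eqP; rewrite eq_complex /= !oppr0 !eqxx. Qed.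

End Exponential.

(** * Algebra of involutions and of skew-hermitian matrices *)

Lemma conj_double (F : numClosedFieldType) (x : F) : x^* = - x -> (2 * x)^* = - (2 * x).
Proof. by move=> xc; rewrite rmorphM rmorph_nat /= xc mulrN. Qed.

(** For x = i pi this is the spectral decomposition of i pi (2 P - 1). *)
Lemma double_sub_scalar (F : comNzRingType) n (x : F) (P : 'M[F]_n) :
  (2 * x) *: P - x%:M = x *: P + (- x) *: (1%:M - P).
Proof.
rewrite scalerBr !scaleNr opprK scalemx1 addrCA -scalerDl addrC.
by rewrite mulr_natl mulr2n.
Qed.

(** Solving Y = x (2 P - 1) for P: the equation Y^2 = x^2 says that P is idempotent. *)
Lemma involution_idempotent (F : fieldType) n (x : F) (Y : 'M[F]_n) : 2 * x != 0 ->
  Y *m Y = (x ^+ 2)%:M ->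
  ((2 * x)^-1 *: (Y + x%:M)) *m ((2 * x)^-1 *: (Y + x%:M)) = (2 * x)^-1 *: (Y + x%:M).
Proof.
move=> x0 YY; rewrite -scalemxAl -scalemxAr; congr (_ *: _).
rewrite mulmxDl !mulmxDr YY mul_scalar_mx mul_mx_scalar mul_scalar_mx.
have -> : (x ^+ 2)%:M + x *: Y + (x *: Y + x *: x%:M) = (2 * x) *: (Y + x%:M).
  by apply/matrixP => i j; rewrite !mxE; case: (i == j); rewrite ?mulr1n ?mulr0n; ring.
by rewrite scalerA mulVf // scale1r.
Qed.

Section SkewHermitian.
Variables (F : numClosedFieldType) (n : nat).
Local Open Scope sesquilinear_scope.
Implicit Types A B : 'M[F]_n.

Lemma adjmxN m p (A : 'M[F]_(m, p)) : (- A)^t* = - A^t*.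
Proof. by rewrite linearN map_mxN. Qed.

Lemma adjmxZ m p a (A : 'M[F]_(m, p)) : (a *: A)^t* = a^* *: A^t*.
Proof. by rewrite linearZ map_mxZ. Qed.

Lemma skewD A B : A^t* = - A -> B^t* = - B -> (A + B)^t* = - (A + B).
Proof. by move=> As Bs; rewrite adjmxD As Bs opprD. Qed.

Lemma skewN A : A^t* = - A -> (- A)^t* = - - A.
Proof. by move=> As; rewrite adjmxN As. Qed.

Lemma skewZ a A : a^* = - a -> A^t* = A -> (a *: A)^t* = - (a *: A).
Proof. by move=> ac Ah; rewrite adjmxZ ac Ah scaleNr. Qed.

Lemma skew_sum (J : finType) (P : pred J) (A : J -> 'M[F]_n) :
  (forall i, (A i)^t* = - A i) -> (\sum_(i | P i) A i)^t* = - \sum_(i | P i) A i.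
Proof.
move=> As; elim/big_ind: _ => [|X Y|i _]; [|exact: skewD|exact: As].
by rewrite trmx0 map_mx0 oppr0.
Qed.

Lemma hermitian_sum (J : finType) (A : J -> 'M[F]_n) :
  (forall i, (A i)^t* = A i) -> (\sum_i A i)^t* = \sum_i A i.
Proof.
move=> As; elim/big_ind: _ => [|X Y Xh Yh|i _]; last exact: As.
  by rewrite trmx0 map_mx0.
by rewrite adjmxD Xh Yh.
Qed.

Lemma skew_div_hermitian a A : a^* = - a -> A^t* = - A -> (a^-1 *: A)^t* = a^-1 *: A.
Proof. by move=> ac As; rewrite adjmxZ As fmorphV /= ac invrN scaleNr scalerN opprK. Qed.

Lemma skew_scalar a : a^* = - a -> (a%:M : 'M[F]_n)^t* = - a%:M.
Proof. by move=> ac; rewrite tr_scalar_mx map_scalar_mx /= ac raddfN. Qed.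

End SkewHermitian.

(** * Principal logarithms parametrised by families of projectors *)

Section PrincipalLogarithms.
Variables (K : realType) (n : nat).
Local Open Scope sesquilinear_scope.
Local Notation C := K[i].

(** Members may vanish, so the index type need not follow the multiplicities. *)
Definition orth_idempotents (J : finType) (F : J -> 'M[C]_n) : Prop :=
  (forall i j, F i *m F j = if i == j then F i else 0) /\ \sum_i F i = 1%:M.

Lemma imc_conj (x : K) : (Complex 0 x : C)^* = - Complex 0 x.
Proof. by apply/eqP; rewrite eq_complex /= oppr0 !eqxx. Qed.

Lemma mul_idempotents (J : finType) (F : J -> 'M[C]_n) (a : J -> C) i :
  orth_idempotents F -> (\sum_j a j *: F j) *m F i = a i *: F i.
Proof.
move=> [FF _]; rewrite mulmx_suml (bigD1 i) //= -scalemxAl FF eqxx.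
by rewrite big1 ?addr0 // => j ji; rewrite -scalemxAl FF (negbTE ji) scaler0.
Qed.

Lemma eigenvalue_idempotents (J : finType) (F : J -> 'M[C]_n) (a : J -> C) x :
  orth_idempotents F -> eigenvalue (\sum_j a j *: F j) x -> exists i, x = a i.
Proof.
move=> oF /eigenvalueP[v vL v0]; have [FF F1] := oF.
have [i vi] : exists i, v *m F i != 0.
  apply: contrapT => nex; move/eqP: v0; apply.
  rewrite -[v]mulmx1 -F1 mulmx_sumr big1 // => i _.
  by apply/eqP; apply: contrapT => /negP vi; apply: nex; exists i.
exists i; have : (x - a i) *: (v *m F i) = 0.
  by rewrite scalerBl scalemxAl -vL -mulmxA mul_idempotents // -scalemxAr subrr.
by move=> /eqP; rewrite scaler_eq0 (negbTE vi) orbF subr_eq0 => /eqP.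
Qed.

(** A skew-hermitian matrix is normal, so it is unitarily diagonalisable. The last clause lets the
    bound on eigenvalues in [plog] apply to each angle [t i]. *)
Lemma skew_hermitian_spectral (L : 'M[C]_n) : L^t* = - L ->
  exists F (t : 'I_n -> K), [/\ orth_idempotents F,
    L = \sum_i Complex 0 (t i) *: F i & forall i, eigenvalue L (Complex 0 (t i))].
Proof.
move=> Ls.
have /orthomx_spectralP LE : L \is normalmx by apply/normalmxP; rewrite Ls mulmxN mulNmx.
set U := spectralmx L in LE; set s := spectral_diag L in LE.
have uU : U \is unitarymx by exact: spectral_unitarymx.
have UU : U *m U^t* = 1%:M by exact/unitarymxP.
have UU' : U^t* *m U = 1%:M by rewrite -invmx_unitary // mulVmx // unitarymx_unit.
rewrite invmx_unitary // in LE.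
(* The diagonal form is again skew-hermitian, so the real parts of its entries vanish. *)
have sE i : s 0 i = Complex 0 (complex.Im (s 0 i)).
  have : diag_mx s = U *m L *m U^t*.
    by rewrite LE !mulmxA UU mul1mx -mulmxA UU mulmx1.
  move=> dE; have : (diag_mx s)^t* = - diag_mx s.
    by rewrite dE !adjmxM trmxCK Ls mulNmx mulmxN mulmxA.
  move=> /matrixP /(_ i i); rewrite !mxE eqxx mulr1n.
  move=> /(congr1 (@complex.Re K)); case: (s 0 i) => a b /= ab.
  by have -> : a = 0 by lra.
pose F i := U^t* *m delta_mx i i *m U.
have FF i j : F i *m F j = if i == j then F i else 0.
  rewrite /F -!mulmxA (mulmxA U) UU mul1mx (mulmxA (delta_mx i i)) mul_delta_mx_cond.
  by case: eqP => [->|_]; rewrite ?mulr1n // mulr0n mul0mx mulmx0.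
have FS (a : 'I_n -> C) : \sum_i a i *: F i = U^t* *m diag_mx (\row_i a i) *m U.
  rewrite diag_mx_sum_delta mulmx_sumr mulmx_suml; apply: eq_bigr => i _.
  by rewrite mxE -scalemxAr -scalemxAl.
exists F, (fun i => complex.Im (s 0 i)); split.
- split=> //; have := FS (fun=> 1).
  under eq_bigr do rewrite scale1r.
  move=> ->; have -> : diag_mx (\row_(i < n) 1) = 1%:M :> 'M[C]_n.
    by apply/matrixP => i j; rewrite !mxE.
  by rewrite mulmx1.
- rewrite FS; have -> : \row_i Complex 0 (complex.Im (s 0 i)) = s; last exact: LE.
  by apply/rowP => i; rewrite mxE -sE.
- move=> i; rewrite -sE; apply/eigenvalueP; exists (row i U).
    rewrite LE mulmxA -row_mul mulmxA UU mul1mx row_diag_mx -scalemxAl.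
    by rewrite -rowE.
  apply/eqP => Ui; have /matrixP /(_ 0 i) : row i U *m U^t* = row i 1%:M.
    by rewrite -row_mul UU.
  by rewrite Ui mul0mx !mxE eqxx => /esym/eqP; rewrite oner_eq0.
Qed.

(** The rows of [Q] are common left eigenvectors of [V] and [M]: row a has eigenvalue [lam (c a)]
    for [V] and angle [al a] for [M]. The map [@e j] enumerates the rows with [c a = j] and angle
    pi, that is, eigenvalue -1 of [M]. *)
Variables (r : nat) (Q : 'M[C]_n) (c : 'I_n -> 'I_r) (lam : 'I_r -> C) (al : 'I_n -> K).
Variables (zeta : 'I_r -> nat) (e : forall j, 'I_(zeta j) -> 'I_n).
Hypotheses (uQ : Q \is unitarymx) (lam_inj : injective lam).
Hypothesis al_range : forall a, - pi < al a <= pi.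
Hypothesis e_inj : forall j, injective (@e j).
Hypothesis eP : forall j a, (exists i, a = @e j i) <-> c a = j /\ al a = pi.

Definition pi_rows j : 'M[C]_(zeta j, n) := rowsub (@e j) Q.
Local Notation W := pi_rows.
Local Notation q b := (row b Q).
Local Notation w := (Complex 0 pi : C).

Lemma row_orthonormal a b : q a *m (q b)^t* = (a == b)%:R%:M.
Proof.
have /unitarymxP QQ := uQ.
apply/matrixP => i j; rewrite !ord1 [RHS]mxE eqxx mulr1n.
transitivity ((Q *m Q^t*) a b); last by rewrite QQ mxE.
by rewrite [LHS]mxE [RHS]mxE; apply: eq_bigr => k _; rewrite !mxE.
Qed.

Lemma row_pi_rows j i : row i (W j) = q (e i).
Proof. by rewrite /W row_rowsub. Qed.

Lemma row_pi_adj b j : ~ (c b = j /\ al b = pi) -> q b *m (W j)^t* = 0.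
Proof.
move=> nb; apply/matrixP => a i; rewrite ord1 [RHS]mxE.
transitivity ((q b *m (q (e i))^t*) 0 0).
  by rewrite [LHS]mxE [RHS]mxE; apply: eq_bigr => k _; rewrite !mxE.
have bi : b != e i by apply/eqP => bi; apply: nb; apply/eP; exists i.
by rewrite row_orthonormal (negbTE bi) mxE eqxx.
Qed.

Lemma pi_rows_adj i j : i != j -> W i *m (W j)^t* = 0.
Proof.
move=> ij; apply/row_matrixP => a; rewrite row_mul row_pi_rows row0.
apply: row_pi_adj => -[ci _]; move/eqP: ij; apply; rewrite -ci.
by apply/esym; apply: (proj1 (iffLR (@eP i (e a)) _)); exists a.
Qed.

Lemma pi_rows_unitary j : W j *m (W j)^t* = 1%:M.
Proof.
apply/matrixP => a b; transitivity ((q (e a) *m (q (e b))^t*) 0 0).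
  by rewrite [LHS]mxE [RHS]mxE; apply: eq_bigr => k _; rewrite !mxE.
by rewrite row_orthonormal (inj_eq (@e_inj j)) !mxE eqxx mulr1n.
Qed.

(** The rows of angle different from pi and the blocks [W j] together exhaust the rows of [Q]. Most
    identities below are checked in this way. *)
Lemma eq_by_rows (A B : 'M[C]_n) :
  (forall b, al b != pi -> q b *m A = q b *m B) ->
  (forall j, W j *m A = W j *m B) -> A = B.
Proof.
move=> AB1 AB2; have : Q *m A = Q *m B.
  apply/row_matrixP => b; rewrite !row_mul.
  have [bpi|/AB1 //] := eqVneq (al b) pi.
  have /eP[i ->] : c b = c b /\ al b = pi by [].
  by rewrite -row_pi_rows -!row_mul AB2.
by move=> /(congr1 (mulmx (Q^t*))); rewrite !mulmxA -invmx_unitary // mulVmx ?unitarymx_unit // !mul1mx.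
Qed.

(** The logarithm with angle -pi on all blocks [W j], where every projector is zero. *)
Definition base_log : 'M[C]_n :=
  \sum_(a | al a != pi) Complex 0 (al a) *: ((q a)^t* *m q a) -
  w *: \sum_j (W j)^t* *m W j.

Definition log_of (Pi : forall j, 'M[C]_(zeta j)) : 'M[C]_n :=
  base_log + \sum_j (2 * w) *: ((W j)^t* *m Pi j *m W j).

Definition log_coord j (L : 'M[C]_n) : 'M[C]_(zeta j) :=
  (2 * w)^-1 *: (W j *m (L - base_log) *m (W j)^t*).

Lemma twow_neq0 : 2 * w != 0.
Proof.
rewrite mulf_neq0 ?pnatr_eq0 // eq_complex /= negb_and; apply/orP; right.
by rewrite gt_eqF // pi_gt0.
Qed.

Lemma row_sum_nonpi (x : 'I_n -> C) b : al b != pi ->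
  q b *m (\sum_(a | al a != pi) x a *: ((q a)^t* *m q a)) = x b *: q b.
Proof.
move=> nb; rewrite mulmx_sumr (bigD1 b) //=.
rewrite -scalemxAr mulmxA.
rewrite row_orthonormal eqxx.
rewrite mul1mx.
rewrite big1 ?addr0 // => a /andP[_ ab].
by rewrite -scalemxAr mulmxA row_orthonormal eq_sym (negbTE ab) -scalemx1 scale0r mul0mx scaler0.
Qed.

Lemma pi_rows_sum_nonpi (x : 'I_n -> C) j :
  W j *m (\sum_(a | al a != pi) x a *: ((q a)^t* *m q a)) = 0.
Proof.
rewrite mulmx_sumr big1 // => a na; rewrite -scalemxAr mulmxA.
have -> : W j *m (q a)^t* = 0.
  rewrite -[LHS]trmxCK adjmxM trmxCK row_pi_adj ?trmx0 ?map_mx0 //.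
  by move=> [_ /eqP]; apply/negP.
by rewrite mul0mx scaler0.
Qed.

Lemma row_sum_pi (X : forall j, 'M[C]_(zeta j)) (x : C) b : al b != pi ->
  q b *m (\sum_j x *: ((W j)^t* *m X j *m W j)) = 0.
Proof.
move=> nb; rewrite mulmx_sumr big1 // => j _.
rewrite -scalemxAr !mulmxA row_pi_adj ?mul0mx ?scaler0 //.
by move=> [_ /eqP]; apply/negP.
Qed.

Lemma pi_rows_sum_pi (X : forall j, 'M[C]_(zeta j)) (x : C) j :
  W j *m (\sum_i x *: ((W i)^t* *m X i *m W i)) = x *: (X j *m W j).
Proof.
rewrite mulmx_sumr (bigD1 j) //= -scalemxAr !mulmxA pi_rows_unitary mul1mx.
rewrite big1 ?addr0 // => i ij.
by rewrite -scalemxAr !mulmxA pi_rows_adj 1?eq_sym // !mul0mx scaler0.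
Qed.

Lemma sum_pi1 (x : C) :
  x *: (\sum_j (W j)^t* *m W j) = \sum_j x *: ((W j)^t* *m 1%:M *m W j).
Proof. by rewrite scaler_sumr; apply: eq_bigr => j _; rewrite mulmx1. Qed.

Lemma row_base_log b : al b != pi -> q b *m base_log = Complex 0 (al b) *: q b.
Proof.
move=> nb; rewrite mulmxBr sum_pi1.
by rewrite (row_sum_nonpi (fun a => Complex 0 (al a))) // row_sum_pi // subr0.
Qed.

Lemma pi_rows_base_log j : W j *m base_log = - w *: W j.
Proof.
rewrite mulmxBr sum_pi1 (pi_rows_sum_nonpi (fun a => Complex 0 (al a))).
by rewrite pi_rows_sum_pi mul1mx sub0r scaleNr.
Qed.

Lemma row_log_of Pi b : al b != pi -> q b *m log_of Pi = Complex 0 (al b) *: q b.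
Proof. by move=> nb; rewrite mulmxDr row_base_log // row_sum_pi // addr0. Qed.

Lemma pi_rows_log_of Pi j :
  W j *m log_of Pi = ((2 * w) *: Pi j - w%:M) *m W j.
Proof.
rewrite mulmxDr pi_rows_base_log pi_rows_sum_pi mulmxBl -scalemxAl mul_scalar_mx.
by rewrite scaleNr addrC.
Qed.

Lemma log_ofK Pi j : log_coord j (log_of Pi) = Pi j.
Proof.
rewrite /log_coord /log_of addrC addKr pi_rows_sum_pi -scalemxAl -mulmxA.
by rewrite pi_rows_unitary mulmx1 scalerA mulVf ?twow_neq0 // scale1r.
Qed.

Lemma log_of_adj Pi : (forall j, (Pi j)^t* = Pi j) -> (log_of Pi)^t* = - log_of Pi.
Proof.
move=> Pia.
have wc : w^* = - w by exact: imc_conj.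
apply: skewD; last first.
  apply: skew_sum => j; apply: skewZ; first exact: conj_double.
  by rewrite !adjmxM trmxCK Pia mulmxA.
apply: skewD.
  apply: skew_sum => a; apply: skewZ; first exact: imc_conj.
  by rewrite adjmxM trmxCK.
apply: skewN; apply: skewZ; first exact: wc.
by apply: hermitian_sum => j; rewrite adjmxM trmxCK.
Qed.

(** Spectral idempotents of [log_of Pi]: one for each row of angle other than pi, and two for each
    block, for the angles pi and -pi. Rows of angle pi are already counted in the blocks, hence the
    0. *)
Definition log_idem (Pi : forall j, 'M[C]_(zeta j)) (x : 'I_n + 'I_r * bool) : 'M[C]_n :=
  match x with
  | inl a => if al a == pi then 0 else (q a)^t* *m q a
  | inr (j, b) => (W j)^t* *m (if b then Pi j else 1%:M - Pi j) *m W j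
  end.

Definition log_angle (x : 'I_n + 'I_r * bool) : K :=
  match x with inl a => al a | inr (_, b) => if b then pi else - pi end.

(** The factor 1 gives the second sum the shape to which [row_sum_pi] and [pi_rows_sum_pi] apply. *)
Lemma log_idem_sum Pi (x : 'I_n + 'I_r * bool -> C) :
  \sum_i x i *: log_idem Pi i =
  \sum_(a | al a != pi) x (inl a) *: ((q a)^t* *m q a) +
  \sum_j 1 *: ((W j)^t* *m (x (inr (j, true)) *: Pi j +
                            x (inr (j, false)) *: (1%:M - Pi j)) *m W j).
Proof.
rewrite big_sumType /=; congr (_ + _).
  rewrite [RHS]big_mkcond; apply: eq_bigr => a _.
  by case: eqP; rewrite ?scaler0.
transitivity (\sum_j \sum_b x (inr (j, b)) *: log_idem Pi (inr (j, b))).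
  by rewrite pair_bigA; apply: eq_bigr => -[].
apply: eq_bigr => j _; rewrite big_bool /= scale1r [X in _ = X *m _]mulmxDr [RHS]mulmxDl.
by rewrite -!scalemxAr -!scalemxAl.
Qed.

Lemma log_idem_orth Pi : (forall j, Pi j *m Pi j = Pi j) ->
  orth_idempotents (log_idem Pi).
Proof.
move=> PP; split.
  have npi a j : al a != pi -> ~ (c a = j /\ al a = pi) by move=> /eqP na [_ /na].
  move=> [a|[j x]] [b|[j' y]] /=.
  - have [ab|ab] := eqVneq a b.
      rewrite -ab eqxx; case: eqP => _; first by rewrite mul0mx.
      by rewrite mulmxA -(mulmxA _ (q a)) row_orthonormal eqxx mulmx1.
    have -> : (inl a == inl b :> 'I_n + 'I_r * bool) = false.
      by apply/negP => /eqP[] /eqP; exact/negP.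
    case: eqP => _; first by rewrite mul0mx.
    case: eqP => _; first by rewrite mulmx0.
    rewrite mulmxA -(mulmxA _ (q a)) row_orthonormal (negbTE ab).
    by rewrite -scalemx1 scale0r mulmx0 mul0mx.
  - case: eqVneq => na; first by rewrite mul0mx.
    by rewrite !mulmxA -(mulmxA _ (q a)) row_pi_adj ?mulmx0 ?mul0mx //; exact: npi.
  - case: eqVneq => na; first by rewrite mulmx0.
    have -> : (W j)^t* *m (if x then Pi j else 1%:M - Pi j) *m W j *m ((q b)^t* *m q b)
        = (W j)^t* *m (if x then Pi j else 1%:M - Pi j) *m (W j *m (q b)^t*) *m q b.
      by rewrite !mulmxA.
    have -> : W j *m (q b)^t* = 0.
      by rewrite -[LHS]trmxCK adjmxM trmxCK row_pi_adj ?trmx0 ?map_mx0 //; exact: npi.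
    by rewrite mulmx0 mul0mx.
  - have [jj|jj] := eqVneq j j'; last first.
      have -> : (inr (j, x) == inr (j', y) :> 'I_n + 'I_r * bool) = false.
        by apply/negP => /eqP[/eqP jj' _]; move: jj; rewrite jj'.
      by rewrite !mulmxA -(mulmxA _ (W j)) pi_rows_adj // mulmx0 !mul0mx.
    case: _ / jj; rewrite !mulmxA -(mulmxA _ (W j)) pi_rows_unitary mulmx1.
    rewrite -(mulmxA _ (if x then _ else _)).
    have -> : (if x then Pi j else 1%:M - Pi j) *m (if y then Pi j else 1%:M - Pi j) =
        if x == y then (if x then Pi j else 1%:M - Pi j) else 0.
      case: x y => [] [] /=; rewrite ?mulmxBl ?mulmxBr ?mul1mx ?mulmx1 ?PP ?subrr ?subr0 //.
    have -> : (inr (j, x) == inr (j, y) :> 'I_n + 'I_r * bool) = (x == y).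
      by apply/eqP/eqP => [[]|->].
    by case: eqP => // _; rewrite mulmx0 mul0mx.
have := log_idem_sum Pi (fun=> 1).
under eq_bigr do rewrite scale1r.
move=> ->; apply: eq_by_rows => [b nb|j].
  by rewrite mulmxDr (row_sum_nonpi (fun=> 1)) // row_sum_pi // addr0 scale1r mulmx1.
rewrite mulmxDr (pi_rows_sum_nonpi (fun=> 1)) pi_rows_sum_pi add0r !scale1r.
by rewrite addrC subrK mul1mx mulmx1.
Qed.

Lemma log_of_spectral Pi : log_of Pi = \sum_i Complex 0 (log_angle i) *: log_idem Pi i.
Proof.
rewrite log_idem_sum; apply: eq_by_rows => [b nb|j].
  rewrite [LHS]row_log_of // [RHS]mulmxDr.
  have /= -> := row_sum_nonpi (fun a => Complex 0 (al a)) nb.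
  by rewrite (row_sum_pi _ 1 nb) addr0.
rewrite [LHS]pi_rows_log_of [RHS]mulmxDr.
have /= -> := pi_rows_sum_nonpi (fun a => Complex 0 (al a)) j.
rewrite add0r (pi_rows_sum_pi _ 1) scale1r.
 congr (_ *m _).
have -> : Complex 0 (- pi) = - w by apply/eqP; rewrite eq_complex /= oppr0 !eqxx.
exact: double_sub_scalar.
Qed.

Lemma row_conj_diag (d : 'rV[C]_n) b :
  q b *m (Q^t* *m diag_mx d *m Q) = d 0 b *: q b.
Proof.
rewrite -row_mul !mulmxA (unitarymxP uQ) mul1mx row_mul row_diag_mx.
by rewrite -scalemxAl -rowE.
Qed.

Variables V M : 'M[C]_n.
Hypothesis VE : V = Q^t* *m diag_mx (\row_a lam (c a)) *m Q.
Hypothesis ME : M = Q^t* *m diag_mx (\row_a expi (al a)) *m Q.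

Lemma row_V b : q b *m V = lam (c b) *: q b.
Proof. by rewrite VE row_conj_diag mxE. Qed.

Lemma row_M b : q b *m M = expi (al b) *: q b.
Proof. by rewrite ME row_conj_diag mxE. Qed.

(** [V] is normal, so adjoints of left eigenvectors are right eigenvectors for the same
    eigenvalue. *)
Lemma V_adj_row b : V *m (q b)^t* = lam (c b) *: (q b)^t*.
Proof.
rewrite -[LHS]trmxCK adjmxM trmxCK.
have -> : V^t* = Q^t* *m diag_mx (\row_a (lam (c a))^*) *m Q.
  rewrite VE !adjmxM trmxCK mulmxA tr_diag_mx map_diag_mx; congr (_ *m diag_mx _ *m _).
  by apply/rowP => a; rewrite !mxE.
by rewrite row_conj_diag mxE adjmxZ conjCK.
Qed.

Lemma pi_rows_V j : W j *m V = lam j *: W j.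
Proof.
apply/row_matrixP => i; rewrite row_mul row_pi_rows row_V linearZ /= row_pi_rows.
by congr (lam _ *: _); apply: (proj1 (iffLR (@eP j (e i)) _)); exists i.
Qed.

Lemma log_of_commutes Pi : log_of Pi *m V = V *m log_of Pi.
Proof.
apply: eq_by_rows => [b nb|j].
  by rewrite mulmxA row_log_of // -scalemxAl row_V mulmxA row_V -scalemxAl row_log_of // !scalerA mulrC.
rewrite mulmxA pi_rows_log_of -mulmxA pi_rows_V -scalemxAr.
by rewrite mulmxA pi_rows_V -scalemxAl pi_rows_log_of.
Qed.

Lemma sum_expi_log_angle Pi : \sum_i expi (log_angle i) *: log_idem Pi i = M.
Proof.
rewrite (log_idem_sum Pi (fun i => expi (log_angle i))); apply: eq_by_rows => [b nb|j].
  rewrite [RHS]row_M [LHS]mulmxDr.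
  have /= -> := row_sum_nonpi (fun a => expi (al a)) nb.
  by rewrite (row_sum_pi _ 1 nb) addr0.
rewrite [LHS]mulmxDr; have /= -> := pi_rows_sum_nonpi (fun a => expi (al a)) j.
rewrite add0r (pi_rows_sum_pi _ 1) scale1r /= expiNpi expi_pi -scalerDr addrC subrK.
apply/row_matrixP => i; rewrite !row_mul !row_pi_rows row_M.
have -> : al (e i) = pi by apply: (proj2 (iffLR (@eP j (e i)) _)); exists i.
by rewrite expi_pi linearZ /= -scalemxAl -row_mul mul1mx row_pi_rows.
Qed.

Lemma log_angle_range i : - pi <= log_angle i <= pi.
Proof.
have p0 := pi_ge0 K; have pp : - pi <= pi :> K by rewrite (le_trans _ p0) // oppr_le0.
case: i => [a|[j []]] /=; [|by rewrite pp lexx|by rewrite pp lexx].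
by have /andP[/ltW -> ->] := al_range a.
Qed.

Lemma plog_log_of Pi : (forall j, Pi j *m Pi j = Pi j) -> (forall j, (Pi j)^t* = Pi j) ->
  plog (commutant (skew_hermitian K n) V) M (log_of Pi).
Proof.
move=> PP Pa; have oF := log_idem_orth PP; split.
- by split; [exact: log_of_adj|exact: log_of_commutes].
- by rewrite log_of_spectral expmx_idempotents ?sum_expi_log_angle //; case: oF.
- rewrite log_of_spectral => x /(eigenvalue_idempotents oF)[i ->].
  exact: log_angle_range.
Qed.

(** * Every principal logarithm comes from a family of projectors *)

Section Converse.
Variable L : 'M[C]_n.
Hypothesis LP : plog (commutant (skew_hermitian K n) V) M L.

Let L_skew : L^t* = - L. Proof. by case: LP => -[]. Qed.
Let L_comm : L *m V = V *m L. Proof. by case: LP => -[]. Qed.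

(** The idempotents of [L] also decompose [M], so row b has components only where exp(i t) equals
    its eigenvalue. By [expi_eq] the angle t is then [al b], except that angle pi also allows -pi,
    and there only the square of [L] is determined. *)
Lemma plog_rows b :
  (al b != pi -> q b *m L = Complex 0 (al b) *: q b) /\
  (al b = pi -> q b *m L *m L = w ^+ 2 *: q b).
Proof.
have [F [t [oF LE tL]]] := skew_hermitian_spectral L_skew.
have [FF F1] := oF.
have t_range i : - pi <= t i <= pi by case: LP => _ _ /(_ _ (tL i)).
have MF : M = \sum_i expi (t i) *: F i.
  by case: LP => _ <- _; rewrite [in LHS]LE expmx_idempotents.
have qF i : q b *m F i != 0 -> expi (t i) = expi (al b).
  move=> qF0; have : (expi (al b) - expi (t i)) *: (q b *m F i) = 0.
    rewrite scalerBl scalemxAl -row_M -mulmxA MF mul_idempotents //.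
    by rewrite -scalemxAr subrr.
  by move=> /eqP; rewrite scaler_eq0 (negbTE qF0) orbF subr_eq0 => /eqP.
have qL (a : 'I_n -> C) x : (forall i, q b *m F i != 0 -> a i = x) ->
    q b *m (\sum_i a i *: F i) = x *: q b.
  move=> ax; rewrite -[q b in RHS]mulmx1 -F1 !mulmx_sumr scaler_sumr.
  apply: eq_bigr => i _; rewrite -scalemxAr.
  by have [->|/ax ->] := eqVneq (q b *m F i) 0; rewrite ?scaler0.
split=> [nb|bpi].
  rewrite LE; apply: qL => i /qF /expi_eq -/(_ (t_range i) (al_range b))[->//|[_ bpi]].
  by rewrite bpi eqxx in nb.
have LLE : L *m L = \sum_i (Complex 0 (t i) ^+ 2) *: F i.
  rewrite {2}LE mulmx_sumr; apply: eq_bigr => i _.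
  by rewrite -scalemxAr LE mul_idempotents // scalerA -expr2.
rewrite -mulmxA LLE; apply: qL => i /qF /expi_eq -/(_ (t_range i) (al_range b))[->|[-> _]].
  by rewrite bpi.
have -> : Complex 0 (- pi) = - w by apply/eqP; rewrite eq_complex /= oppr0 !eqxx.
by rewrite sqrrN.
Qed.

(* The image of the [j]-th block under [L] is orthogonal to the other
   eigenvectors, since [L] is skew-hermitian and commutes with [V]. *)
Lemma plog_invariant j : W j *m L = W j *m L *m (W j)^t* *m W j.
Proof.
set X := W j *m L.
have Xq b : ~ (c b = j /\ al b = pi) -> X *m (q b)^t* = 0.
  (* If row b has angle pi, it belongs to another eigenvalue of [V], and commutation separates them.
     Otherwise it is an eigenvector of [L], and skewness moves [L] onto it. *)
  move=> nb; have [bpi|bpi] := eqVneq (al b) pi.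
    have cb : c b != j by apply/eqP => cb; exact: nb.
    have : (lam j - lam (c b)) *: (X *m (q b)^t*) = 0.
      rewrite scalerBl scalemxAl /X scalemxAl -pi_rows_V.
      by rewrite scalemxAr -V_adj_row -(mulmxA _ V L) -L_comm !mulmxA subrr.
    by move=> /eqP; rewrite scaler_eq0 subr_eq0 (inj_eq lam_inj) eq_sym (negbTE cb) => /eqP.
  have -> : X *m (q b)^t* = (q b *m L^t* *m (W j)^t*)^t*.
    by rewrite !adjmxM !trmxCK mulmxA.
  have -> : q b *m L^t* = - (Complex 0 (al b) *: q b).
    by rewrite L_skew mulmxN (plog_rows b).1.
  by rewrite mulNmx -scalemxAl row_pi_adj // scaler0 oppr0 trmx0 map_mx0.
(* The difference is orthogonal to the rows of [W j] by projection and to the other rows of [Q] by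
   [Xq]; hence it vanishes. *)
have XY : (X - X *m (W j)^t* *m W j) *m Q^t* = 0.
  have XqY b : (X - X *m (W j)^t* *m W j) *m (q b)^t* = 0.
    have [[cb bpi]|nb] := pselect (c b = j /\ al b = pi); last first.
      rewrite mulmxBl Xq // -!mulmxA.
      have -> : W j *m (q b)^t* = 0.
        by rewrite -[LHS]trmxCK adjmxM trmxCK row_pi_adj // trmx0 map_mx0.
      by rewrite !mulmx0 subrr.
    have : (X - X *m (W j)^t* *m W j) *m (W j)^t* = 0.
      by rewrite mulmxBl -(mulmxA _ (W j)) pi_rows_unitary mulmx1 subrr.
    have /eP[i ->] : c b = j /\ al b = pi by [].
    move=> XW; apply/matrixP => a z; rewrite ord1 [RHS]mxE.
    have /matrixP /(_ a i) := XW; rewrite [X in _ = X -> _]mxE => <-.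
    by rewrite [LHS]mxE [RHS]mxE; apply: eq_bigr => k _; rewrite !mxE.
  apply/matrixP => a b; rewrite [RHS]mxE; have /matrixP /(_ a 0) := XqY b.
  rewrite [X in _ = X -> _]mxE => <-.
  by rewrite [LHS]mxE [RHS]mxE; apply: eq_bigr => k _; rewrite !mxE.
apply/eqP; rewrite -subr_eq0; apply/eqP.
rewrite -[LHS]mulmx1.
have <- : Q^t* *m Q = 1%:M by rewrite -invmx_unitary // mulVmx // unitarymx_unit.
by rewrite mulmxA XY mul0mx.
Qed.

Lemma plog_coord j : let Y := W j *m L *m (W j)^t* in
  log_coord j L = (2 * w)^-1 *: (Y + w%:M).
Proof.
rewrite /log_coord mulmxBr pi_rows_base_log mulmxBl -scalemxAl pi_rows_unitary.
by rewrite scaleNr opprK scalemx1.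
Qed.

(** By invariance, the compression of [L] to block j squares to the compression of the square of
    [L], which is the scalar (i pi)^2. *)
Lemma plog_idem j : log_coord j L *m log_coord j L = log_coord j L.
Proof.
rewrite plog_coord; set Y := _ *m (W j)^t*.
have YY : Y *m Y = (w ^+ 2)%:M.
  rewrite /Y !mulmxA -plog_invariant.
  have -> : W j *m L *m L = w ^+ 2 *: W j.
    apply/row_matrixP => i; rewrite linearZ /= !row_mul row_pi_rows.
    by apply: (plog_rows _).2; apply: (proj2 (iffLR (@eP j (e i)) _)); exists i.
  by rewrite -scalemxAl pi_rows_unitary scalemx1.
exact: involution_idempotent twow_neq0 YY.
Qed.

Lemma plog_coord_adj j : (log_coord j L)^t* = log_coord j L.
Proof.
rewrite plog_coord; apply: (skew_div_hermitian (conj_double (imc_conj pi))).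
apply: skewD; first by rewrite !adjmxM trmxCK L_skew mulNmx mulmxN mulmxA.
exact/skew_scalar/imc_conj.
Qed.

Lemma plog_coordK : log_of (log_coord^~ L) = L.
Proof.
apply: eq_by_rows => [b nb|j].
  by rewrite row_log_of // (plog_rows b).1.
rewrite pi_rows_log_of plog_coord scalerA mulfV ?twow_neq0 // scale1r addrK.
by rewrite -plog_invariant.
Qed.

End Converse.

End PrincipalLogarithms.

(** * Block-diagonal matrices and the commutant of V *)

Section BlockSums.
Variables (K : realType) (n r : nat) (n_ : 'I_r -> nat) (sum_n : (\sum_j n_ j)%N = n).
Local Open Scope sesquilinear_scope.
Local Notation C := K[i].
Local Notation blocks := (block_sum sum_n).
Implicit Types A B : forall j, 'M[C]_(n_ j).

Lemma block_sumM A B : blocks A *m blocks B = blocks (fun j => A j *m B j).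
Proof.
rewrite /block_sum; case: n / sum_n => /=; rewrite !castmx_id.
rewrite [X in _ *m X]/mxdiag mul_mxdiag_mxblock; apply: eq_mxblock => i j.
case: eqVneq => [<-|_]; last by rewrite mulmx0.
by rewrite !conform_mx_id.
Qed.

Lemma block_sum_adj A : (blocks A)^t* = blocks (fun j => (A j)^t*).
Proof.
rewrite /block_sum; case: n / sum_n => /=; rewrite !castmx_id tr_mxdiag.
apply/matrixP => a b; rewrite !mxE; case: eqP => [ab|_]; last by rewrite !mxE conjC0.
case: _ / ab (tagnat.sig2 b) => i; by rewrite !conform_mx_id !mxE.
Qed.

Lemma block_sum1 : blocks (fun j => 1%:M : 'M[C]_(n_ j)) = 1%:M.
Proof. by rewrite /block_sum; case: n / sum_n => /=; rewrite castmx_id mxdiagZ. Qed.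

Lemma block_sum_inj A B : blocks A = blocks B -> forall j, A j = B j.
Proof.
by rewrite /block_sum; case: n / sum_n => /=; rewrite !castmx_id => /eq_mxdiagP.
Qed.

Lemma block_sum_unitary A : (forall j, A j \is unitarymx) <-> blocks A \is unitarymx.
Proof.
split=> [uA|/unitarymxP uA j].
  apply/unitarymxP; rewrite block_sum_adj block_sumM -block_sum1; congr block_sum.
  by apply: functional_extensionality_dep => j; exact/unitarymxP.
move: uA; rewrite block_sum_adj block_sumM -block_sum1 => /block_sum_inj /(_ j) uA.
exact/unitarymxP.
Qed.

(** The block (i, j) of the commutation relation reads (lam_j - lam_i) X_ij = 0. *)
Lemma commute_block_sum (lam : 'I_r -> C) (X : 'M[C]_n) : injective lam ->
  X *m blocks (fun j => (lam j)%:M) = blocks (fun j => (lam j)%:M) *m X ->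
  exists A, X = blocks A.
Proof.
move=> lam_inj; rewrite /block_sum; case: n / sum_n X => X /=; rewrite !castmx_id.
rewrite -[X]submxblockK mul_mxblock_mxdiag mul_mxdiag_mxblock => /eq_mxblockP XX.
exists (fun j => submxblock X j j); rewrite castmx_id; apply: eq_mxblock => i j.
case: eqVneq => [<-|ij]; first by rewrite conform_mx_id.
have := XX i j; rewrite mul_mx_scalar mul_scalar_mx => /eqP.
rewrite -subr_eq0 -scalerBl scaler_eq0 subr_eq0 (inj_eq lam_inj) eq_sym (negbTE ij) /=.
by move/eqP.
Qed.

Lemma Ad_unitary (P X : 'M[C]_n) : P \is unitarymx -> Ad P X = P *m X *m P^t*.
Proof. by move=> uP; rewrite /Ad invmx_unitary. Qed.

Lemma AdK (P X : 'M[C]_n) : P \is unitarymx -> P^t* *m Ad P X *m P = X.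
Proof.
move=> uP; have PP : P^t* *m P = 1%:M by rewrite -invmx_unitary // mulVmx // unitarymx_unit.
by rewrite Ad_unitary // !mulmxA PP mul1mx -mulmxA PP mulmx1.
Qed.

Lemma AdVK (P X : 'M[C]_n) : P \is unitarymx -> Ad P (P^t* *m X *m P) = X.
Proof.
move=> uP; have PP : P *m P^t* = 1%:M by exact/unitarymxP.
by rewrite Ad_unitary // !mulmxA PP mul1mx -mulmxA PP mulmx1.
Qed.

Lemma AdM (P X Y : 'M[C]_n) : P \is unitarymx -> Ad P X *m Ad P Y = Ad P (X *m Y).
Proof.
move=> uP; have PP : P^t* *m P = 1%:M by rewrite -invmx_unitary // mulVmx // unitarymx_unit.
by rewrite !Ad_unitary // -!mulmxA (mulmxA (P^t*)) PP mul1mx.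
Qed.

Lemma unitary_Ad (P X : 'M[C]_n) : P \is unitarymx ->
  (Ad P X \is unitarymx) = (X \is unitarymx).
Proof.
move=> uP; have uP' : P^t* \is unitarymx by rewrite trmxC_unitary.
have E := Ad_unitary X uP.
apply/idP/idP => uX; last by rewrite E; exact: (mul_unitarymx (mul_unitarymx uP uX) uP').
rewrite -(AdK X uP); exact: (mul_unitarymx (mul_unitarymx uP' uX) uP).
Qed.

Theorem commutant_unitary_blocks (lam : 'I_r -> C) (P M : 'M[C]_n) :
  injective lam -> P \is unitarymx ->
  commutant (unitary_group K n) (Ad P (blocks (fun j => (lam j)%:M))) M <->
  exists A, (forall j, unitary_group K (n_ j) (A j)) /\ M = Ad P (blocks A).
Proof.
move=> lam_inj uP; split=> [[uM MV]|[A [uA ->]]].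
  have [|A XA] := @commute_block_sum lam (P^t* *m M *m P) lam_inj.
    move: MV; rewrite -{1 2}(AdVK M uP) !AdM // => MV.
    by rewrite -[LHS](AdK _ uP) -[RHS](AdK _ uP) MV.
  exists A; rewrite -XA AdVK //; split=> // j.
  apply: (proj2 (block_sum_unitary A)); rewrite -XA.
  by rewrite -(unitary_Ad _ uP) AdVK.
have uA' : blocks A \is unitarymx by apply/block_sum_unitary; exact: uA.
split; first by rewrite -(unitary_Ad _ uP) in uA'.
rewrite (AdM _ _ uP) (AdM _ _ uP) !block_sumM; congr (Ad P (block_sum _ _)).
by apply: functional_extensionality_dep => j; rewrite mul_mx_scalar mul_scalar_mx.
Qed.

End BlockSums.

(** * Multiplicities of roots of characteristic polynomials *)

Section Multiplicity.
Variable F : fieldType.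

Lemma mup_prod_XsubC (I : Type) (s : seq I) (d : I -> F) a :
  mup a (\prod_(i <- s) ('X - (d i)%:P)) = count (fun i => d i == a) s.
Proof.
elim: s => [|i s IH]; first by rewrite big_nil mupNroot // root1.
rewrite big_cons mupM ?polyXsubC_eq0 //.
  by rewrite IH -[X in mup a X]expr1 mup_XsubCX /=; case: eqP.
by rewrite monic_neq0 // monic_prod_XsubC.
Qed.

Lemma char_poly_similar n (A B U : 'M[F]_n) : U *m A = 1%:M ->
  char_poly (A *m B *m U) = char_poly B.
Proof.
move=> UA; have AU : A *m U = 1%:M by exact: mulmx1C.
have E : char_poly_mx (A *m B *m U) =
    map_mx polyC A *m char_poly_mx B *m map_mx polyC U.
  rewrite /char_poly_mx !map_mxM mulmxBr mulmxBl mul_mx_scalar -scalemxAl.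
  by rewrite -[map_mx polyC A *m map_mx polyC U]map_mxM AU map_mx1 scalemx1.
rewrite /char_poly E !det_mulmx mulrAC [X in X * _]mulrC.
by rewrite -det_mulmx -[map_mx polyC U *m map_mx polyC A]map_mxM UA map_mx1 det1 mul1r.
Qed.

End Multiplicity.

Lemma enum_subtype m (p : pred 'I_m) k : k = #|p| ->
  exists2 g : 'I_k -> 'I_m, injective g & forall i, (exists x, i = g x) <-> p i.
Proof.
move=> ->; exists (fun x => enum_val x); first exact: enum_val_inj.
move=> i; split=> [[x ->]|pi]; first by have := enum_valP x.
by exists (enum_rank_in pi i); rewrite enum_rankK_in.
Qed.

(** * Simultaneous diagonalisation of V and M *)

Section FlatData.
Variables (K : realType) (n r : nat) (n_ : 'I_r -> nat) (sum_n : (\sum_j n_ j)%N = n).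
Local Open Scope sesquilinear_scope.
Local Notation C := K[i].
Local Notation blocks := (block_sum sum_n).

(** Eigenvalues have modulus 1 and get angles in (-pi, pi]. Similarity reduces the multiplicity of
    -1 to a count of diagonal entries, that is, of angles equal to pi. *)
Lemma unitary_spectral m (A : 'M[C]_m) : A \is unitarymx ->
  exists (U : 'M[C]_m) (t : 'I_m -> K), [/\ U \is unitarymx,
    A = U^t* *m diag_mx (\row_i expi (t i)) *m U,
    forall i, - pi < t i <= pi &
    exists2 g : 'I_(eigen_mult A (-1)) -> 'I_m, injective g &
      forall i, (exists x, i = g x) <-> t i = pi].
Proof.
move=> uA; have AA : A *m A^t* = 1%:M by exact/unitarymxP.
have AA' : A^t* *m A = 1%:M by rewrite -invmx_unitary // mulVmx // unitarymx_unit.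
have /orthomx_spectralP AE : A \is normalmx by apply/normalmxP; rewrite AA AA'.
set U := spectralmx A in AE; set s := spectral_diag A in AE.
have uU : U \is unitarymx by exact: spectral_unitarymx.
have UU : U *m U^t* = 1%:M by exact/unitarymxP.
rewrite invmx_unitary // in AE.
have s1 i : `|s 0 i| = 1.
  have dE : diag_mx s = U *m A *m U^t*.
    by rewrite AE !mulmxA UU mul1mx -mulmxA UU mulmx1.
  have : diag_mx s *m (diag_mx s)^t* = 1%:M.
    have uU' : U^t* \is unitarymx by rewrite trmxC_unitary.
    apply/unitarymxP; rewrite dE; exact: (mul_unitarymx (mul_unitarymx uU uA) uU').
  rewrite tr_diag_mx map_diag_mx mulmx_diag => /matrixP /(_ i i).
  rewrite !mxE eqxx !mulr1n -normCK => /eqP.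
  by rewrite sqrp_eq1 // => /eqP.
have /choice[t tP] i : exists t, (- pi < t <= pi) /\ expi t = s 0 i.
  by have [t t1 t2] := expi_surj (s1 i); exists t.
have sE : s = \row_i expi (t i) by apply/rowP => i; rewrite mxE (tP i).2.
exists U, t; split=> //; first by rewrite -sE.
  by move=> i; exact: (tP i).1.
have [|g g_inj gP] := @enum_subtype m (fun i => t i == pi) (eigen_mult A (-1)).
  rewrite /eigen_mult AE char_poly_similar // char_poly_trig ?diag_mx_is_trig //.
  under eq_bigr do rewrite mxE eqxx mulr1n sE mxE.
  rewrite -big_enum mup_prod_XsubC -sum1_count -sum1_card big_enum_cond.
  apply: eq_bigl => i; rewrite [LHS]/= [RHS]unfold_in.
  (* Exponential -1 forces angle pi, since -pi is excluded from the range. *)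
  apply/eqP/eqP => [ti|->]; last exact: expi_pi.
  have p0 := pi_gt0 K.
  have := @expi_eq K (t i) pi; rewrite expi_pi ti.
  have /andP[t0 t1] := (tP i).1; rewrite (ltW t0) t1 => /(_ isT).
  rewrite lexx andbT (lt_trans _ p0) ?oppr_lt0 // => /(_ isT erefl)[//|[tN _]].
  by move: t0; rewrite tN ltxx.
exists g => // i; split; first by move=> /gP/eqP.
by move=> /eqP ti; exact/gP.
Qed.

(** Each block of [M] is diagonalised by its own unitary matrix. These preserve the scalar blocks of
    [V], so the block sum, composed with the adjoint of [P], diagonalises both. *)
Lemma flat_diagonalization (lam : 'I_r -> C) (P : 'M[C]_n) (M_ : forall j, 'M[C]_(n_ j))
    (zeta : 'I_r -> nat) : P \is unitarymx -> (forall j, M_ j \is unitarymx) ->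
  (forall j, zeta j = eigen_mult (M_ j) (-1)) ->
  exists (Q : 'M[C]_n) (c : 'I_n -> 'I_r) (al : 'I_n -> K) (e : forall j, 'I_(zeta j) -> 'I_n),
   [/\ Q \is unitarymx, forall a, - pi < al a <= pi,
       (forall j, injective (@e j)) /\
       (forall j a, (exists i, a = @e j i) <-> c a = j /\ al a = pi),
       Ad P (blocks (fun j => (lam j)%:M)) = Q^t* *m diag_mx (\row_a lam (c a)) *m Q &
       Ad P (blocks M_) = Q^t* *m diag_mx (\row_a expi (al a)) *m Q].
Proof.
move=> uP uM zE.
have ex j : exists Ut : 'M[C]_(n_ j) * ('I_(n_ j) -> K), [/\ Ut.1 \is unitarymx,
    M_ j = Ut.1^t* *m diag_mx (\row_i expi (Ut.2 i)) *m Ut.1,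
    forall i, - pi < Ut.2 i <= pi &
    exists2 g : 'I_(zeta j) -> 'I_(n_ j), injective g &
      forall i, (exists x, i = g x) <-> Ut.2 i = pi].
  by have [U [t tP]] := unitary_spectral (uM j); exists (U, t); rewrite zE.
pose Ut j := projT1 (cid (ex j)).
have UtP j := projT2 (cid (ex j)).
have exg j : exists g : 'I_(zeta j) -> 'I_(n_ j),
    injective g /\ forall i, (exists x, i = g x) <-> (Ut j).2 i = pi.
  by have [_ _ _ [g g1 g2]] := UtP j; exists g.
pose g j := projT1 (cid (exg j)).
have gP j := projT2 (cid (exg j)).
have uU : blocks (fun j => (Ut j).1) \is unitarymx.
  by apply/block_sum_unitary => j; have [] := UtP j.
pose Q := blocks (fun j => (Ut j).1) *m P^t*.
have uP' : P^t* \is unitarymx := etrans (trmxC_unitary P) uP.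
have uQ : Q \is unitarymx by exact: (mul_unitarymx uU uP').
have QE A : Q^t* *m A *m Q = Ad P (blocks (fun j => (Ut j).1^t*) *m A *m blocks (fun j => (Ut j).1)).
  by rewrite (Ad_unitary _ uP) /Q adjmxM trmxCK block_sum_adj !mulmxA.
(* Decodes a flat index into its block and the position inside the block. *)
pose sg (a : 'I_n) := tagnat.sig (cast_ord (esym sum_n) a).
pose c a := tag (sg a).
pose al a := (Ut (tag (sg a))).2 (tagged (sg a)).
pose e j (i : 'I_(zeta j)) : 'I_n := cast_ord sum_n (tagnat.Rank j (@g j i)).
have sge j i : sg (@e j i) = Tagged _ (@g j i).
  by rewrite /sg /e cast_ordK tagnat.rankK.
have diagE (f : forall j, 'I_(n_ j) -> C) :
    diag_mx (\row_a f (tag (sg a)) (tagged (sg a))) =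
    blocks (fun j => diag_mx (\row_i f j i)).
  rewrite /sg /block_sum -diag_mxrow; case: n / sum_n => /=; rewrite castmx_id.
  congr diag_mx; apply/rowP => a; rewrite !mxE.
  by rewrite cast_ord_id.
exists Q, c, al, e; split=> //.
- by move=> a; have [_ _ + _] := UtP (tag (sg a)); apply.
- split=> [j i i' /(congr1 sg)|j a].
    by rewrite !sge => /eqP; rewrite eq_Tagged /= => /eqP /(gP j).1.
  split=> [[i ->]|]; first by rewrite /c /al sge /=; split=> //; apply/(gP j).2; exists i.
  have sgP (p : {j : 'I_r & 'I_(n_ j)}) : tag p = j -> (Ut (tag p)).2 (tagged p) = pi ->
      exists i, cast_ord sum_n (tagnat.rank p) = @e j i.
    by case: p => j' i' /= <- /(gP j').2[x ->]; exists x.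
  move=> [c1 c2]; have [x ax] := sgP _ c1 c2; exists x.
  by rewrite -ax /sg tagnat.sigK cast_ordKV.
- rewrite QE (diagE (fun j _ => lam j)) !block_sumM; congr (Ad P (block_sum _ _)).
  apply: functional_extensionality_dep => j; have [uUj _ _ _] := UtP j.
  have -> : diag_mx (\row_i lam j) = (lam j)%:M :> 'M[C]_(n_ j).
    by apply/matrixP => x y; rewrite !mxE.
  by rewrite mul_mx_scalar -scalemxAl -invmx_unitary // mulVmx ?unitarymx_unit // scalemx1.
- rewrite QE (diagE (fun j i => expi ((Ut j).2 i))) !block_sumM.
  by congr (Ad P (block_sum _ _)); apply: functional_extensionality_dep => j; have [] := UtP j.
Qed.

End FlatData.

(** * Real coordinates for tuples of complex matrices *)

Section RealCoordinates.
Variable K : realType.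
Local Notation C := K[i].

Lemma realifyK m n (X : 'M[C]_(m, n)) : complexify (realify X) = X.
Proof. by apply/matrixP => i j; rewrite !mxE; case: (X i j). Qed.

Lemma smooth_on_coord m n (D : set 'M[K]_(m, n)) i j : open D ->
  smooth_on D (fun X : 'M[K]_(m, n) => X i j : K^o).
Proof.
move=> oD k.
pose f : 'M[K]_(m, n) -> K^o := fun X => X i j.
have fl : linear f by move=> a X Y; rewrite /f !mxE.
pose fL := GRing.isLinear.Build _ _ _ _ f fl.
pose L : {linear 'M[K]_(m, n) -> K^o} := HB.pack f fL.
apply: (@Ck_on_linear K _ _ k D L oD) => X; exact: coord_continuous.
Qed.

Lemma smooth_on_pair_coord m n (D : set ('M[K]_(m, n) * 'M[K]_(m, n))) i j : open D ->
  smooth_on D (fun X : 'M[K]_(m, n) * 'M[K]_(m, n) => X.1 i j : K^o) /\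
  smooth_on D (fun X : 'M[K]_(m, n) * 'M[K]_(m, n) => X.2 i j : K^o).
Proof.
move=> oD; split=> k.
  pose f : 'M[K]_(m, n) * 'M[K]_(m, n) -> K^o := fun X => X.1 i j.
  have fl : linear f by move=> a X Y; rewrite /f /= !mxE.
  pose fL := GRing.isLinear.Build _ _ _ _ f fl.
  pose L : {linear ('M[K]_(m, n) * 'M[K]_(m, n))%type -> K^o} := HB.pack f fL.
  apply: (@Ck_on_linear K _ _ k D L oD) => X.
  by apply: (@cvg_comp _ _ _ fst (fun Y : 'M[K]_(m, n) => Y i j)); [exact: cvg_fst|exact: coord_continuous].
pose f : 'M[K]_(m, n) * 'M[K]_(m, n) -> K^o := fun X => X.2 i j.
have fl : linear f by move=> a X Y; rewrite /f /= !mxE.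
pose fL := GRing.isLinear.Build _ _ _ _ f fl.
pose L : {linear ('M[K]_(m, n) * 'M[K]_(m, n))%type -> K^o} := HB.pack f fL.
apply: (@Ck_on_linear K _ _ k D L oD) => X.
by apply: (@cvg_comp _ _ _ snd (fun Y : 'M[K]_(m, n) => Y i j)); [exact: cvg_snd|exact: coord_continuous].
Qed.

Lemma mxsmooth_complexify m n (D : set ('M[K]_(m, n) * 'M[K]_(m, n))) : open D ->
  mxsmooth D (fun X => complexify X : 'M[C]_(m, n)).
Proof.
move=> oD i j; have [s1 s2] := smooth_on_pair_coord i j oD; split=> k.
  by apply: (eq_Ck_on oD _ (s1 k)) => X _; rewrite mxE.
by apply: (eq_Ck_on oD _ (s2 k)) => X _; rewrite mxE.
Qed.

Variables (r : nat) (k z : 'I_r -> nat).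
Local Notation d := (prod_Gr_dim k z).

(** The inverse of [graph_coord], with all real parts before all imaginary parts. *)
Definition coord_of_graph (X : forall j, 'M[C]_(k j, z j - k j)) : 'rV[K]_(d + d) :=
  let y : 'rV[C]_d := \mxrow_j mxvec (X j) in
  row_mx (map_mx (@complex.Re K) y) (map_mx (@complex.Im K) y).

Lemma coord_of_graphK X j : graph_coord (coord_of_graph X) j = X j.
Proof.
rewrite /graph_coord /coord_of_graph row_mxKl row_mxKr.
have -> : complexify (map_mx (@complex.Re K) (\mxrow_j mxvec (X j)),
    map_mx (@complex.Im K) (\mxrow_j mxvec (X j))) = \mxrow_j mxvec (X j).
  exact: realifyK.
by rewrite mxrowK mxvecK.
Qed.

Lemma graph_coord_eq (w : 'rV[K]_(d + d)) X : (forall j, graph_coord w j = X j) ->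
  coord_of_graph X = w.
Proof.
move=> wX; rewrite /coord_of_graph.
have -> : \mxrow_j mxvec (X j) = complexify (lsubmx w, rsubmx w).
  rewrite -[RHS]submxrowK; apply: eq_mxrow => j.
  by rewrite -wX /graph_coord vec_mxK.
have [-> ->] : (map_mx (@complex.Re K) (complexify (lsubmx w, rsubmx w)) = lsubmx w) /\
    (map_mx (@complex.Im K) (complexify (lsubmx w, rsubmx w)) = rsubmx w).
  by split; apply/matrixP => i j; rewrite !mxE.
by rewrite hsubmxK.
Qed.

Lemma mxsmooth_graph_coord (D : set 'rV[K]_(d + d)) j : open D ->
  mxsmooth D (fun w => graph_coord w j).
Proof.
move=> oD a b.
(* The flat position of entry (a, b) of factor j; its real and imaginary parts sit at the left and
   right shifts of [s]. *)
pose s := tagnat.Rank j (mxvec_index a b) : 'I_d.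
split=> l.
  apply: (eq_Ck_on oD _ (smooth_on_coord 0 (lshift d s) oD l)) => w _.
  by rewrite /graph_coord !mxE.
apply: (eq_Ck_on oD _ (smooth_on_coord 0 (rshift d s) oD l)) => w _.
by rewrite /graph_coord !mxE.
Qed.

Lemma smooth_on_coord_of_graph (V : normedModType K) (D : set V)
    (X : V -> forall j, 'M[C]_(k j, z j - k j)) : open D ->
  (forall j, mxsmooth D (fun v => X v j)) -> smooth_on D (fun v => coord_of_graph (X v)).
Proof.
move=> oD sX; apply: smooth_on_mx => // i s; rewrite (ord1 i).
have idx (t : 'I_d) : exists a b, tagnat.sig2 t = mxvec_index a b.
  by case: (mxvec_indexP (tagnat.sig2 t)) => a b; exists a, b.
case: (split_ordP s) => t ->; have [a [b tab]] := idx t => l.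
  apply: (eq_Ck_on oD _ ((sX (tagnat.sig1 t) a b).1 l)) => v _.
  by rewrite /coord_of_graph row_mxEl !mxE tab mxvecE.
apply: (eq_Ck_on oD _ ((sX (tagnat.sig1 t) a b).2 l)) => v _.
by rewrite /coord_of_graph row_mxEr !mxE tab mxvecE.
Qed.

End RealCoordinates.

(** * Smooth structure of a family of projectors of prescribed ranks *)

Section ProjectorProduct.
Variables (K : realType) (n r : nat) (zeta : 'I_r -> nat).
Local Open Scope sesquilinear_scope.
Local Notation C := K[i].
Variables (L0 : 'M[C]_n) (W : forall j, 'M[C]_(zeta j, n)) (a b : C).

(** This is [log_of] with its constants abstracted; from here on it is used through its affine left
    inverse. *)
Definition affine_map (Pi : forall j, 'M[C]_(zeta j)) : 'M[C]_n :=
  L0 + \sum_j a *: ((W j)^t* *m Pi j *m W j).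

Definition affine_coord j (L : 'M[C]_n) : 'M[C]_(zeta j) :=
  b *: (W j *m (L - L0) *m (W j)^t*).

Lemma eq_affine_map Pi Pi' : (forall j, Pi j = Pi' j) -> affine_map Pi = affine_map Pi'.
Proof. by move=> E; rewrite (functional_extensionality_dep E). Qed.

Hypothesis affine_mapK : forall Pi j, affine_coord j (affine_map Pi) = Pi j.

Definition projector_family (k : 'I_r -> nat) : set 'M[C]_n :=
  affine_map @` [set Pi | forall j, orthproj (k j) (Pi j)].

Variable k : 'I_r -> nat.
Local Notation Z := (projector_family k).
Local Notation d := (prod_Gr_dim k zeta).
Local Notation S := (@realify K n n @` Z).

Lemma projector_familyP L : Z L ->
  (forall j, orthproj (k j) (affine_coord j L)) /\ affine_map (affine_coord^~ L) = L.
Proof.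
move=> [Pi oPi <-]; split=> [j|]; first by rewrite affine_mapK.
by apply: eq_affine_map => j; rewrite affine_mapK.
Qed.

Section Charts.
Variables (A : forall j, 'M[C]_(k j, zeta j)) (B : forall j, 'M[C]_(zeta j - k j, zeta j)).
Hypothesis fAB : forall j, frame (A j) (B j).

Definition projector_chart (w : 'rV[K]_(d + d)) : 'M[K]_n * 'M[K]_n :=
  realify (affine_map (fun j => chart_map (A j) (B j) (graph_coord w j))).

(** [chart_coord] is a rational formula that makes sense for all matrices with invertible
    compressions, not for projectors only. It thus extends the inverse of the chart smoothly to the
    open set [O]. *)
Lemma projector_chart_local_params :
  local_params (d + d) S (setT, projector_chart).
Proof.
have oT : open [set: 'rV[K]_(d + d)] by exact: openT.
have oT2 : open [set: 'M[K]_n * 'M[K]_n] by exact: openT.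
split; first exact: oT.
  apply: smooth_on_realify => //; apply: mxsmoothD => //; first exact: mxsmooth_cst.
  apply: mxsmooth_sum => // j; apply: mxsmoothZ => //; apply: mxsmoothM => //; last exact: mxsmooth_cst.
  apply: mxsmoothM => //; first exact: mxsmooth_cst.
  have sG : mxsmooth setT (fun w => A j + graph_coord w j *m B j).
    apply: mxsmoothD => //; first exact: mxsmooth_cst.
    by apply: mxsmoothM => //; [exact: mxsmooth_graph_coord|exact: mxsmooth_cst].
  apply: mxsmoothM => //; apply: mxsmoothM => //; first exact: mxsmooth_adj.
  apply: mxsmooth_inv => //; first by move=> w _; exact/unitmx_gram/chart_free.
  by apply: mxsmoothM => //; exact: mxsmooth_adj.
pose cf j (X : 'M[K]_n * 'M[K]_n) := affine_coord j (complexify X).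
have scf D j : open D -> mxsmooth D (cf j).
  move=> oD; apply: mxsmoothZ => //; apply: mxsmoothM => //; last exact: mxsmooth_cst.
  apply: mxsmoothM => //; first exact: mxsmooth_cst.
  by apply: mxsmoothD => //; [exact: mxsmooth_complexify|exact: mxsmooth_cst].
have scA D j : open D -> mxsmooth D (fun X => A j *m cf j X *m (A j)^t*).
  move=> oD; apply: mxsmoothM => //; last exact: mxsmooth_cst.
  by apply: mxsmoothM => //; [exact: mxsmooth_cst|exact: scf].
pose O := [set X | forall j, A j *m cf j X *m (A j)^t* \in unitmx].
have oO : open O.
  pose det X := \prod_j \det (A j *m cf j X *m (A j)^t*).
  have sdet : csmooth setT det.
    by apply: csmooth_prod => // j; apply: csmooth_det => //; exact: scA.
  (* The squared modulus of the product of the determinants: a continuous real function that is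
     nonzero exactly on [O]. *)
  pose N X : K^o := complex.Re (det X) * complex.Re (det X) +
    complex.Im (det X) * complex.Im (det X).
  have [cN _] : Ck_on 0 setT N.
    exact: (Ck_onD oT2 (Ck_onM oT2 (sdet.1 0%N) (sdet.1 0%N))
                       (Ck_onM oT2 (sdet.2 0%N) (sdet.2 0%N))).
  have -> : O = N @^-1` [set x | x != 0].
    apply/seteqP; split=> X; rewrite /O /N /= -!expr2 paddr_eq0 ?sqr_ge0 // !sqrf_eq0 => OX.
      have : det X != 0.
        by apply/prodf_neq0 => j _; have := OX j; rewrite unitmxE unitfE.
      by rewrite eq_complex.
    move=> j; rewrite unitmxE unitfE.
    have : det X != 0 by rewrite eq_complex.
    by move=> /prodf_neq0 /(_ j isT).
  apply: open_comp => [X _|]; first exact: cN.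
  exact: open_neq.
exists O, (fun X => coord_of_graph (fun j => chart_coord (A j) (B j) (cf j X))); split.
- exact: oO.
- apply: smooth_on_coord_of_graph => // j; apply: mxsmoothM => //.
    by apply: mxsmooth_inv => //; exact: scA.
  apply: mxsmoothM => //; last exact: mxsmooth_cst.
  by apply: mxsmoothM => //; [exact: mxsmooth_cst|exact: scf].
- apply/seteqP; split=> [_ [w _ <-]|X [[L ZL <-]] OX].
    split.
      exists (affine_map (fun j => chart_map (A j) (B j) (graph_coord w j))) => //.
      exists (fun j => chart_map (A j) (B j) (graph_coord w j)) => // j.
      exact: orthproj_chart.
    by move=> j; rewrite /cf /= realifyK affine_mapK; exact: chart_map_unit.
  have [oL LE] := projector_familyP ZL.
  exists (coord_of_graph (fun j => chart_coord (A j) (B j) (affine_coord j L))) => //.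
  rewrite /projector_chart /=; apply: (congr1 (@realify K n n)); rewrite -[RHS]LE.
  apply: eq_affine_map => j; rewrite coord_of_graphK.
  apply: (chart_coordK (fAB j) (oL j)).
  by have := OX j; rewrite /cf realifyK.
- move=> w _; apply: graph_coord_eq => j.
  by rewrite /cf /= realifyK affine_mapK chart_mapK.
Qed.

Definition grassmannian_chart (w : 'rV[K]_(d + d)) j : {vspace 'rV[C]_(zeta j)} :=
  row_space (A j + graph_coord w j *m B j).

Lemma grassmannian_chart_atlas : prod_Gr_atlas K k zeta (setT, grassmannian_chart).
Proof.
exists A, B; split=> // j; have [_ _ _ E] := fAB j.
apply/row_fullP; exists (row_mx ((A j)^t*) ((B j)^t*)).
by rewrite mul_row_col.
Qed.

Lemma row_space_chart w j :
  row_space (chart_map (A j) (B j) (graph_coord w j)) = grassmannian_chart w j.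
Proof.
by apply: eq_row_space; exact: (orthproj_on (chart_free (fAB j) _)).2.
Qed.

End Charts.

Lemma adapted_frame (Pi : forall j, 'M[C]_(zeta j)) : (forall j, orthproj (k j) (Pi j)) ->
  exists (A : forall j, 'M[C]_(k j, zeta j)) B,
    (forall j, frame (A j) (B j)) /\
    exists w : 'rV[K]_(d + d), forall j, chart_map (A j) (B j) (graph_coord w j) = Pi j.
Proof.
move=> oPi.
have ex j : exists AB : 'M[C]_(k j, zeta j) * 'M[C]_(zeta j - k j, zeta j),
    frame AB.1 AB.2 /\ AB.1 *m Pi j *m AB.1^t* \in unitmx.
  (* Applied to one projector taken twice, [common_frame] gives a chart around it. *)
  by have [A [B [fAB uA _]]] := common_frame (oPi j) (oPi j); exists (A, B).
pose AB j := projT1 (cid (ex j)); have ABP j := projT2 (cid (ex j)).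
exists (fun j => (AB j).1), (fun j => (AB j).2); split=> [j|]; first exact: (ABP j).1.
exists (coord_of_graph (fun j => chart_coord (AB j).1 (AB j).2 (Pi j))) => j.
by rewrite coord_of_graphK; apply: (chart_coordK (ABP j).1 (oPi j) (ABP j).2).
Qed.

Lemma projector_family_submanifold : submanifold (d + d) S.
Proof.
move=> _ [L [Pi oPi <-] <-].
have [A [B [fAB [w wPi]]]] := adapted_frame oPi.
exists (setT, projector_chart A B); first exact: projector_chart_local_params.
exists w; first exact: Logic.I.
by rewrite /= /projector_chart (eq_affine_map wPi).
Qed.

Lemma projector_family_diffeomorphic :
  diffeomorphic (local_params (d + d) S) S (prod_Gr_atlas K k zeta) (prod_Gr K k zeta).
Proof.
pose f (X : 'M[K]_n * 'M[K]_n) j := row_space (affine_coord j (complexify X)).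
pose g (U : forall j, {vspace 'rV[C]_(zeta j)}) := realify (affine_map (fun j => proj_of (U j))).
have sid : smooth_on setT (id : 'rV[K]_(d + d) -> 'rV[K]_(d + d)).
  by apply: smooth_on_id; exact: openT.
have fchart A B w : (forall j, frame (A j) (B j)) ->
    f (projector_chart A B w) = grassmannian_chart A B w.
  move=> fAB; apply: functional_extensionality_dep => j.
  by rewrite /f /projector_chart realifyK affine_mapK row_space_chart.
have gchart A B w : (forall j, frame (A j) (B j)) ->
    g (grassmannian_chart A B w) = projector_chart A B w.
  move=> fAB; rewrite /g /projector_chart; apply: (congr1 (@realify K n n)).
  apply: eq_affine_map => j; rewrite -(row_space_chart fAB).
  by rewrite (proj_of_row_space (orthproj_chart (fAB j) _)).
have oproj U : prod_Gr K k zeta U -> forall j, orthproj (k j) (proj_of (U j)).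
  by move=> GU j; have := orthproj_proj_of (U j); rewrite (GU j).
exists f, g; split.
- split=> [_ [_ [L ZL <-] <-] j|_ [U GU <-]].
    have [oL _] := projector_familyP ZL; have [_ _ rL] := oL j.
    by rewrite /Gr /= /f realifyK dim_row_space.
  exists (affine_map (fun j => proj_of (U j))) => //.
  by exists (fun j => proj_of (U j)) => // j; exact: oproj.
- move=> _ [L ZL <-]; have [oL LE] := projector_familyP ZL.
  have E j : proj_of (f (realify L) j) = affine_coord j L.
    by rewrite /f realifyK (proj_of_row_space (oL j)).
  by rewrite /g (eq_affine_map E) LE.
- move=> U GU; apply: functional_extensionality_dep => j.
  by rewrite /f /g realifyK affine_mapK row_space_proj_of.
- move=> _ [_ [Pi oPi <-] <-]; have [A [B [fAB [w wPi]]]] := adapted_frame oPi.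
  exists (setT, projector_chart A B), (setT, grassmannian_chart A B), w, setT, id; split.
  + split; [exact: projector_chart_local_params|exact: grassmannian_chart_atlas].
  + by split; [exact: Logic.I|rewrite /= /projector_chart (eq_affine_map wPi)].
  + by split; [exact: openT|exact: Logic.I|].
  + by split; [exact: sid|].
  + by move=> w' _; rewrite /= fchart.
move=> U GU; have [A [B [fAB [w wPi]]]] := adapted_frame (oproj U GU).
exists (setT, grassmannian_chart A B), (setT, projector_chart A B), w, setT, id; split.
- split; [exact: grassmannian_chart_atlas|exact: projector_chart_local_params].
- split; first exact: Logic.I.
  apply: functional_extensionality_dep => j.
  by rewrite /= -(row_space_chart fAB) wPi row_space_proj_of.
- by split; [exact: openT|exact: Logic.I|].
- by split; [exact: sid|].
- by move=> w' _; rewrite /= gchart.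
Qed.

End ProjectorProduct.

(** * Topology of the families and of their union *)

Section ProjectorProductTopology.
Variables (K : realType) (n r : nat) (zeta : 'I_r -> nat).
Local Open Scope sesquilinear_scope.
Local Notation C := K[i].
Local Notation I := [set t : K | 0 <= t <= 1].
Variables (L0 : 'M[C]_n) (W : forall j, 'M[C]_(zeta j, n)) (a b : C).
Local Notation F := (affine_map L0 W a).
Local Notation G := (affine_coord L0 W b).
Hypothesis affine_mapK : forall Pi j, G j (F Pi) = Pi j.

Lemma cvg_affine_map (T : topologicalType) (E : set_system T) {FE : Filter E}
    (f : forall j, T -> 'M[C]_(zeta j)) Pi :
  (forall j, f j @ E --> Pi j) -> (fun x => F (fun j => f j x)) @ E --> F Pi.
Proof.
move=> fPi; have cst m p (A : 'M[C]_(m, p)) : (fun _ : T => A) @ E --> A by exact: cvg_cst.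
apply: (cvg_mxD (cst _ _ _)); apply: cvg_big => [|j _]; first exact: add_continuous.
apply: cvg_mxZ; first exact: cvg_cst.
exact: (cvg_mxM (cvg_mxM (cst _ _ _) (fPi j)) (cst _ _ _)).
Qed.

Lemma cvg_affine_coord (T : topologicalType) (E : set_system T) {FE : Filter E} j
    (f : T -> 'M[C]_n) (L : 'M[C]_n) :
  f @ E --> L -> (fun x => G j (f x)) @ E --> G j L.
Proof.
move=> fL; have cst m p (A : 'M[C]_(m, p)) : (fun _ : T => A) @ E --> A by exact: cvg_cst.
apply: cvg_mxZ; first exact: cvg_cst.
apply: (cvg_mxM _ (cst _ _ _)); apply: (cvg_mxM (cst _ _ _)).
exact: (cvgB fL (cst _ _ _)).
Qed.

Section FixedRanks.
Variable k : 'I_r -> nat.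
Local Notation Z := (projector_family L0 W a k).
Local Notation Proj j := [set P : 'M[C]_(zeta j) | orthproj (k j) P].

Lemma projector_family_path L L' : Z L -> Z L' -> exists p : K -> 'M[C]_n, path_in Z L L' p.
Proof.
move=> [Pi oPi <-] [Pi' oPi' <-].
have ex j : exists p : K -> 'M[C]_(zeta j), path_in (Proj j) (Pi j) (Pi' j) p.
  by apply: projector_path; [exact: oPi|exact: oPi'].
pose p j := projT1 (cid (ex j)); have pP j := projT2 (cid (ex j)).
exists (fun t => F (fun j => p j t)); split.
- apply/subspace_continuousP => t It; apply: cvg_affine_map => j.
  by case: (pP j) => /subspace_continuousP cp _ _ _; exact: cp.
- move=> _ [t It <-]; exists (fun j => p j t) => // j.
  by case: (pP j) => _ pS _ _; apply: pS; exists t.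
- by apply: eq_affine_map => j; case: (pP j).
- by apply: eq_affine_map => j; case: (pP j).
Qed.

(** A loop is sent to each factor by the affine coordinates, contracted there, and the homotopies
    are reassembled by the affine map. *)
Lemma projector_family_simply_connected : (forall j, (k j <= zeta j)%N) ->
  simply_connected K Z.
Proof.
move=> kz; split.
- have ex j : exists P : 'M[C]_(zeta j), orthproj (k j) P.
    by have [P oP] := projector_nonempty K (kz j); exists P.
  exists (F (fun j => projT1 (cid (ex j)))), (fun j => projT1 (cid (ex j))) => // j.
  exact: (projT2 (cid (ex j))).
- exact: projector_family_path.
move=> L p [cp pS p0 p1].
have pZ t : I t -> Z (p t) by move=> It; apply: pS; exists t.
have I0 : I 0 by rewrite /= lexx ler01.
have [oL LE] : (forall j, orthproj (k j) (G j L)) /\ F (G^~ L) = L.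
  by rewrite -p0; exact: projector_familyP (pZ 0 I0).
have ex j : null_homotopic (Proj j) (G j L) (fun t => G j (p t)).
  apply: projector_null_homotopic; first exact: oL.
  split.
  - apply/subspace_continuousP => t It; apply: cvg_affine_coord.
    by move/subspace_continuousP: cp; apply.
  - by move=> _ [t It <-]; exact: (projector_familyP affine_mapK (pZ t It)).1.
  - by rewrite p0.
  - by rewrite p1.
pose H j := projT1 (cid (ex j)); have HP j := projT2 (cid (ex j)).
exists (fun st => F (fun j => H j st)); split.
- apply/subspace_continuousP => st Ist; apply: cvg_affine_map => j.
  by case: (HP j) => /subspace_continuousP cH _ _ _; exact: cH.
- move=> _ [st Ist <-]; exists (fun j => H j st) => // j.
  by case: (HP j) => _ HS _ _; apply: HS; exists st.
- move=> t It; split.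
    rewrite -[RHS](projector_familyP affine_mapK (pZ t It)).2.
    by apply: eq_affine_map => j; case: (HP j) => _ _ /(_ t It)[E _] _; exact: E.
  rewrite -[RHS]LE; apply: eq_affine_map => j.
  by case: (HP j) => _ _ /(_ t It)[_ E] _; exact: E.
- move=> s Is; split; rewrite -[RHS]LE; apply: eq_affine_map => j.
    by case: (HP j) => _ _ _ /(_ s Is)[E _]; exact: E.
  by case: (HP j) => _ _ _ /(_ s Is)[_ E]; exact: E.
Qed.

(** The continuous image of a product of compact sets, the factors having different types. *)
Lemma projector_family_compact : compact Z.
Proof.
pose X j : topologicalType := 'M[C]_(zeta j).
pose T := prod_topology X.
have cj j : @compact (X j) (Proj j) by exact: projector_compact.
have cP : @compact T [set Pi | forall j, Proj j (Pi j)].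
  exact: (@tychonoff 'I_r X (fun j => Proj j) cj).
have cF : continuous (F : T -> 'M[C]_n).
  move=> Pi; apply: (@cvg_affine_map T (nbhs Pi) _ (fun j (f : T) => f j) Pi) => j.
  exact: (@proj_continuous _ X j Pi).
exact: (continuous_compact (continuous_subspaceT cF) cP).
Qed.

End FixedRanks.

(** Projectors of all ranks at once: for the data of a logarithm this is the whole set of
    logarithms. *)
Definition projector_union : set 'M[C]_n :=
  F @` [set Pi | forall j, Pi j *m Pi j = Pi j /\ (Pi j)^t* = Pi j].

Lemma projector_family_sub k : projector_family L0 W a k `<=` projector_union.
Proof. by move=> _ [Pi oPi <-]; exists Pi => // j; have [? ? _] := oPi j. Qed.

Lemma projector_union_family L : projector_union L ->
  projector_family L0 W a (fun j => \rank (G j L)) L.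
Proof.
move=> [Pi PiP <-]; exists Pi => // j; have [? ?] := PiP j.
by split=> //; rewrite affine_mapK.
Qed.

(* The rank of a projector is its trace, which is continuous. *)
Lemma projector_union_component k L : projector_family L0 W a k L ->
  connected_component projector_union L = projector_family L0 W a k.
Proof.
move=> ZL; apply/seteqP; split=> [L' [A [AL AU cA] AL']|L' ZL'].
  have [oL _] := projector_familyP affine_mapK ZL.
  have [oL' LE'] := projector_familyP affine_mapK (projector_union_family (AU _ AL')).
  exists (G^~ L'); last exact: LE'.
  move=> j; split; [by have [] := oL' j|by have [] := oL' j|].
  pose t (X : 'M[C]_n) : K := complex.Re (\tr (G j X)).
  have tE X l : orthproj l (G j X) -> t X = l%:R.
    by move=> oX; rewrite /t (orthproj_trace oX) -[l%:R](rmorph_nat (real_complex K)).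
  have ct : continuous t.
    move=> X; have cG : G j @ X --> G j X by exact: (@cvg_affine_coord _ (nbhs X) _ j id X cvg_id).
    have ctr : {for X, continuous (fun Y => \tr (G j Y))}.
      exact: (@cvg_mxtrace _ _ (nbhs X) (nbhs_filter X) _ _ _ cG).
    exact: (continuous_comp ctr (@continuous_Re K _)).
  have : connected (t @` A).
    by apply: connected_continuous_connected cA _; exact: continuous_subspaceT.
  move=> /connected_intervalP itv.
  have tA : (t @` A) (k j)%:R by exists L => //; exact: tE (oL j).
  have tA' : (t @` A) (\rank (G j L'))%:R by exists L' => //; exact: tE (oL' j).
  have tN x : (t @` A) x -> exists l : nat, x = l%:R.
    move=> [X AX <-]; exists (\rank (G j X)); apply: tE.
    exact: (projector_familyP affine_mapK (projector_union_family (AU _ AX))).1.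
  (* The traces over a connected set form an interval of natural numbers; two different values would
     force a half-integer. *)
  have nogap (l m : nat) : (t @` A) l%:R -> (t @` A) m%:R -> (l < m)%N -> False.
    move=> Al Am lm.
    have [|q qE] := tN (l%:R + 2^-1).
      apply: (itv _ _ Al Am); apply/andP; split; first by rewrite lerDl invr_ge0.
      apply: (@le_trans _ _ l.+1%:R); last by rewrite ler_nat.
      by rewrite -[X in _ <= X]natr1 lerD2l invf_le1 // ler1n.
    have : (l%:R < q%:R :> K) by rewrite -qE ltrDl invr_gt0.
    have : (q%:R < l.+1%:R :> K) by rewrite -qE -[X in _ < X]natr1 ltrD2l invf_lt1 // ltr1n.
    by rewrite !ltr_nat ltnS => ql /leq_trans -/(_ _ ql); rewrite ltnn.
  have [lt|lt|//] := ltngtP (\rank (G j L')) (k j).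
    by case: (nogap _ _ tA' tA lt).
  by case: (nogap _ _ tA tA' lt).
have [p [cp pS p0 p1]] := projector_family_path ZL ZL'.
exists (p @` I); last by exists 1 => //=; rewrite ler01 lexx.
split.
- by exists 0 => //=; rewrite ler01 lexx.
- by apply: subset_trans pS _; exact: projector_family_sub.
- apply: connected_continuous_connected cp.
  have -> : I = `[0, 1]%classic by apply/seteqP; split=> x; rewrite /= in_itv.
  exact: segment_connected.
Qed.

End ProjectorProductTopology.

(** * Counting the labels, and the conclusion *)

Lemma card_eq_finType (T : finType) : ([set: T] #= `I_#|T|)%card.
Proof.
apply/card_set_bijP; exists (fun x => nat_of_ord (enum_rank x)); split.
- by move=> x _; exact: ltn_ord.
- by move=> x y _ _ /ord_inj /enum_rank_inj.
- by move=> i /= iT; exists (enum_val (Ordinal iT)) => //; rewrite enum_valK.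
Qed.

Lemma card_dffun_ord r (z : 'I_r -> nat) :
  #|{dffun forall j : 'I_r, 'I_(z j).+1}| = (\prod_j (z j + 1))%N.
Proof.
rewrite card_dep_ffun foldrE big_map big_enum.
by apply: eq_bigr => j _; rewrite card_ord addn1.
Qed.

Theorem theorem7p2 (K : realType) (n : nat) (V : 'M[K[i]]_n)
    (hV : V \is unitarymx)
    (r : nat) (lambda : 'I_r -> K[i]) (n_ : 'I_r -> nat)
    (lambda_inj : injective lambda)
    (lambda_eigen : forall a : K[i], eigenvalue V a <-> exists j, a = lambda j)
    (n_mult : forall j, n_ j = eigen_mult V (lambda j))
    (sum_n : (\sum_j n_ j)%N = n)
    (P : 'M[K[i]]_n) (hP : P \is unitarymx)
    (V_diag : V = Ad P (block_sum sum_n (fun j => (lambda j)%:M))) :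
  (forall M : 'M[K[i]]_n,
     commutant (unitary_group K n) V M <->
     exists M_ : forall j, 'M[K[i]]_(n_ j),
       (forall j, unitary_group K (n_ j) (M_ j)) /\
       M = Ad P (block_sum sum_n M_))
  /\
  (forall (M : 'M[K[i]]_n) (M_ : forall j, 'M[K[i]]_(n_ j)) (zeta : 'I_r -> nat),
     (forall j, unitary_group K (n_ j) (M_ j)) ->
     M = Ad P (block_sum sum_n M_) ->
     commutant (unitary_group K n) V M ->
     (forall j, zeta j = eigen_mult (M_ j) (-1)) ->
     let L := plog (commutant (skew_hermitian K n) V) M in
     (components L #= `I_(\prod_j (zeta j + 1)))%card /\
     exists Z : {dffun forall j : 'I_r, 'I_(zeta j).+1} -> set 'M[K[i]]_n,
       set_bij setT (components L) Z /\
       forall k : {dffun forall j : 'I_r, 'I_(zeta j).+1},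
         [/\ simply_connected K (Z k),
             compact (Z k),
             Z k `<=` skew_hermitian K n &
             let S := @realify K n n @` Z k in
             exists m : nat,
               submanifold m S /\
               diffeomorphic (local_params m S) S
                 (prod_Gr_atlas K (fun j => k j : nat) zeta)
                 (prod_Gr K (fun j => k j : nat) zeta)]).
Proof.
split=> [M|M M_ zeta uM ME MV zE L].
  by rewrite V_diag; exact: commutant_unitary_blocks.
have [Q [c [al [e [uQ al_range [e_inj eP] VE QE]]]]] :=
  flat_diagonalization sum_n lambda hP uM zE.
rewrite -V_diag in VE; rewrite -ME in QE.
pose L0 := base_log Q al e; pose W := pi_rows Q e.
(* The gap 2 i pi between the eigenvalues -i pi and i pi. *)
pose a : K[i] := 2 * Complex 0 pi.
have mapK Pi j : affine_coord L0 W a^-1 j (affine_map L0 W a Pi) = Pi j.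
  exact: (log_ofK uQ e_inj eP).
have LE : L = projector_union L0 W a.
  apply/seteqP; split=> [X LX|_ [Pi PiP <-]].
    exists (fun j => log_coord Q al e j X); last exact: (plog_coordK uQ lambda_inj al_range e_inj eP VE QE LX).
    move=> j; split; first exact: (plog_idem uQ lambda_inj al_range e_inj eP VE QE LX).
    exact: (plog_coord_adj uQ e_inj eP LX).
  apply: (plog_log_of uQ al_range e_inj eP VE QE) => j; first exact: (PiP j).1.
  exact: (PiP j).2.
pose Z (k : {dffun forall j : 'I_r, 'I_(zeta j).+1}) :=
  projector_family L0 W a (fun j => k j : nat).
have kz (k : {dffun forall j : 'I_r, 'I_(zeta j).+1}) j : (k j <= zeta j)%N.
  by rewrite -ltnS ltn_ord.
have Zsc k : simply_connected K (Z k).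
  by apply: (projector_family_simply_connected mapK) => j; exact: kz.
have Zcomp k X : Z k X -> connected_component L X = Z k.
  by move=> ZX; rewrite LE; exact: (projector_union_component mapK ZX).
have Zbij : set_bij setT (components L) Z.
  split.
  - move=> k _; have [[X ZX] _ _] := Zsc k.
    exists X; last exact: Zcomp.
    by rewrite LE; exact: projector_family_sub ZX.
  (* Any point of a nonempty family determines its labels, as the ranks of its coordinates. *)
  - move=> k k' _ _ ZZ; have [[X ZX] _ _] := Zsc k.
    have [oX _] := projector_familyP mapK ZX.
    have [oX' _] : (forall j, orthproj (k' j) (affine_coord L0 W a^-1 j X)) /\
        affine_map L0 W a (fun j => affine_coord L0 W a^-1 j X) = X.
      by apply: (projector_familyP mapK); rewrite -[projector_family _ _ _ _]/(Z k') -ZZ.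
    apply/ffunP => j; apply: val_inj => /=.
    by have [_ _ <-] := oX j; have [_ _ <-] := oX' j.
  - move=> _ [X LX <-]; rewrite LE in LX.
    have ZX := projector_union_family mapK LX.
    have rk j : (\rank (affine_coord L0 W a^-1 j X) < (zeta j).+1)%N.
      by rewrite ltnS rank_leq_row.
    pose k : {dffun forall j : 'I_r, 'I_(zeta j).+1} := [ffun j => Ordinal (rk j)].
    exists k => //; apply/esym/Zcomp; rewrite /Z.
    have -> : (fun j => k j : nat) = (fun j => \rank (affine_coord L0 W a^-1 j X)).
      by apply/funext => j; rewrite /k ffunE.
    exact: ZX.
split.
  rewrite -card_dffun_ord; apply: card_eq_trans (card_eq_finType _).
  by apply/card_esym/card_set_bijP; exists Z.
exists Z; split=> // k; split.
- exact: Zsc.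
- exact: projector_family_compact.
- move=> X ZX; have : L X by rewrite LE; exact: projector_family_sub ZX.
  by case=> -[].
(* The real dimension is twice the complex one. *)
- exists (prod_Gr_dim (fun j => k j : nat) zeta + prod_Gr_dim (fun j => k j : nat) zeta)%N.
  split; first exact: (projector_family_submanifold mapK).
  exact: (projector_family_diffeomorphic mapK).
Qed.
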